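(* Let $\gamma$ be a constant with $\gamma\ge f_y(x,y)$ for all $(x,y)\in[0,1]\times\mathbb{R}$. Let $y$ be the solution of the boundary value problem $\varepsilon^2y''=f(x,y)$ on $[0,1]$, $y(0)=y(1)=0$, and let $\overline{y}=(\overline{y}_0,\ldots,\overline{y}_N)^T$ be the solution of the discrete problem $F\overline{y}=0$ on the modified Bakhvalov mesh $x_i=\varphi(i/N)$, $i=0,\ldots,N$. Then the discrete problem is uniformly convergent with respect to $\varepsilon$, and $$\max_{0\le i\le N}|y(x_i)-\overline{y}_i|\le \frac{C}{N^2},$$ where $C>0$ is a constant independent of $N$ and $\varepsilon$.
   Context: Problem: $f\in C^k([0,1]\times\mathbb{R})$ for some $k\ge2$ and $f_y=\partial f/\partial y\ge m>0$ on $[0,1]\times\mathbb{R}$, with $m$ a constant; the boundary value problem then has a unique solution $y$. Mesh: fix $\varepsilon^\star<1/8$ (positive), $p\in((\varepsilon^\star)^{1/3},1/2)$, and let $\varepsilon\in(0,\varepsilon^\star]$, $\alpha=p-\varepsilon^{1/3}>0$. The mesh points are $x_i=\varphi(t_i)$, $t_i=i/N$, $i=0,\ldots,N$, where $N$ is even, $N\ge4$, and $$\varphi(t)=\begin{cases}\kappa(t):=\dfrac{a\varepsilon t}{p-t}, & t\in[0,\alpha],\\[1mm] \pi(t):=\omega(t-\alpha)^3+\tfrac12\kappa''(\alpha)(t-\alpha)^2+\kappa'(\alpha)(t-\alpha)+\kappa(\alpha), & t\in[\alpha,1/2],\\[1mm] 1-\varphi(1-t), & t\in[1/2,1].\end{cases}$$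 The coefficient $\omega$ is determined by $\pi(1/2)=1/2$, i.e. $$\omega=\left(\tfrac12-\alpha\right)^{-3}\left\{\tfrac12-a\left[p\left(\tfrac12-\alpha\right)^2+p\left(\tfrac12-\alpha\right)\varepsilon^{1/3}+\alpha\varepsilon^{2/3}\right]\right\},$$ and $a>0$ is a constant independent of $\varepsilon$ chosen such that $\omega\ge0$. Put $h_i=x_{i+1}-x_i$, $i=0,\ldots,N-1$. Discrete problem: let $q>0$ be a fixed real number and $\beta=\sqrt\gamma/\varepsilon$ with $\gamma$ a constant. For $i=1,\ldots,N$ set $a_i=1/\sinh(\beta h_{i-1})$, $d_i=1/\tanh(\beta h_{i-1})$, $\triangle d_i=d_i-a_i$ (the numbers $a_i$ are not to be confused with the mesh parameter $a$). For $u=(u_0,\ldots,u_N)^T\in\mathbb{R}^{N+1}$ let $Fu=(F_0u,\ldots,F_Nu)^T$ with $F_0u=u_0$, $F_Nu=u_N$, and for $i=1,\ldots,N-1$ $$F_iu=\frac{\gamma}{\triangle d_i+\triangle d_{i+1}}\Big\{\big[(q+1)a_i+d_i+\triangle d_{i+1}\big](u_{i-1}-u_i)-\big[(q+1)a_{i+1}+d_{i+1}+\triangle d_i\big](u_i-u_{i+1})-\frac{f(x_{i-1},u_{i-1})+q f(x_i,u_i)+f(x_{i+1},u_{i+1})}{\gamma}(\triangle d_i+\triangle d_{i+1})\Big\}.$$ Constants: ''independent of $N$ and $\varepsilon$'' means that $C$ may depend on the fixed data $f,m,\gamma,q,p,a,\varepsilon^\star$ only. *)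

(* Defs.v *)
From Stdlib Require Import Reals.
From Coquelicot Require Import Coquelicot.
Open Scope R_scope.

(** * Continuous problem *)

Definition unit_interval (x : R) : Prop := 0 <= x <= 1.

Definition strip (z : R * R) : Prop := unit_interval (fst z).

(** [Ck_strip k f]: f is in C^k([0,1] x R).  Only the values of [f] on the
    strip matter: derivatives in x are taken relative to [0,1], hence are
    one-sided at x = 0 and x = 1, and continuity is relative to the strip. *)
Fixpoint Ck_strip (k : nat) (f : R -> R -> R) : Prop :=
  continuous_on strip (fun z : R * R => f (fst z) (snd z)) /\
  match k with
  | O => True
  | S k' =>
      exists fx fy : R -> R -> R,
        (forall x v : R, unit_interval x ->
           D_in (fun s => f s v) (fun s => fx s v) unit_interval x /\
           is_derive (f x) v (fy x v)) /\
        Ck_strip k' fx /\ Ck_strip k' fy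
  end.

(** eps^2 y'' = f(x,y) on [0,1], y(0) = y(1) = 0, with derivatives relative to
    [0,1].  For continuous [f] the equation itself makes y'' continuous, so
    these are exactly the C^2([0,1]) solutions. *)
Definition bvp_solution (f : R -> R -> R) (eps : R) (y : R -> R) : Prop :=
  (exists y' y'' : R -> R,
     forall x : R, unit_interval x ->
       D_in y y' unit_interval x /\
       D_in y' y'' unit_interval x /\
       eps ^ 2 * y'' x = f x (y x)) /\
  y 0 = 0 /\ y 1 = 0.

(** * Modified Bakhvalov mesh *)

Definition alpha (p eps : R) : R := p - Rpower eps (1 / 3).

Definition kappa (a p eps t : R) : R := a * eps * t / (p - t).

Definition omega (a p eps : R) : R :=
  let al := alpha p eps in
  / (1 / 2 - al) ^ 3 *
  (1 / 2 - a * (p * (1 / 2 - al) ^ 2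
                + p * (1 / 2 - al) * Rpower eps (1 / 3)
                + al * Rpower eps (2 / 3))).

Definition pi_mesh (a p eps t : R) : R :=
  let al := alpha p eps in
  omega a p eps * (t - al) ^ 3
  + 1 / 2 * Derive_n (kappa a p eps) 2 al * (t - al) ^ 2
  + Derive (kappa a p eps) al * (t - al)
  + kappa a p eps al.

Definition phi_left (a p eps t : R) : R :=
  if Rle_dec t (alpha p eps) then kappa a p eps t else pi_mesh a p eps t.

Definition phi (a p eps t : R) : R :=
  if Rle_dec t (1 / 2) then phi_left a p eps t
  else 1 - phi_left a p eps (1 - t).

Definition mesh (a p eps : R) (N i : nat) : R := phi a p eps (INR i / INR N).

(** * Discrete problem

    A vector (u_0, ..., u_N) is a function [nat -> R] of which only the entries
    with index at most N are used; the same holds for the mesh points [x]. *)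

Section Scheme.

Variables (f : R -> R -> R) (gamma q eps : R) (N : nat) (x : nat -> R).

Definition beta : R := sqrt gamma / eps.

Definition step (i : nat) : R := x (S i) - x i.

Definition a_coef (i : nat) : R := / sinh (beta * step (i - 1)).

Definition d_coef (i : nat) : R := / tanh (beta * step (i - 1)).

Definition delta_d (i : nat) : R := d_coef i - a_coef i.

Definition F_interior (u : nat -> R) (i : nat) : R :=
  gamma / (delta_d i + delta_d (i + 1)) *
  (((q + 1) * a_coef i + d_coef i + delta_d (i + 1)) * (u (i - 1)%nat - u i)
   - ((q + 1) * a_coef (i + 1) + d_coef (i + 1) + delta_d i)
     * (u i - u (i + 1)%nat)
   - (f (x (i - 1)%nat) (u (i - 1)%nat) + q * f (x i) (u i)
      + f (x (i + 1)%nat) (u (i + 1)%nat)) / gamma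
     * (delta_d i + delta_d (i + 1))).

Definition F (u : nat -> R) (i : nat) : R :=
  if Nat.eqb i 0 then u O
  else if Nat.eqb i N then u N
  else F_interior u i.

Definition discrete_solution (u : nat -> R) : Prop :=
  forall i : nat, (i <= N)%nat -> F u i = 0.

End Scheme.

(* Main.v *)
Require Import Defs.
From Stdlib Require Import Reals Lra Lia Classical ClassicalEpsilon List.
From Coquelicot Require Import Coquelicot.
Open Scope R_scope.

(** The proof combines stability of the scheme with a bound for its truncation
    error in the maximum norm that is uniform in eps.

    Stability.  Since f_v lies between m and gamma, the difference of two grid
    functions solves a three-point relation whose off-diagonal coefficients are
    nonnegative (the neighbours enter with weight at least gamma - f_v) and whose
    zero-order coefficient is at least (q+2)m ([error_equation]).  The discrete
    maximum principle then bounds the error by the truncation error divided by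
    (q+2)m.

    Truncation error.  Put g(x) = gamma y(x) - f(x,y(x)) = gamma y - eps^2 y''.  The
    operator splits into q+2 times an exponentially fitted scheme for
    eps^2 y'' - gamma y = -g, plus the second difference of g ([F_interior_split]).
    The fitted scheme is exact on exp(beta x) and exp(-beta x), so its error is
    g(x_i) minus a weighted mean of g with positive weights, and the first moment
    of these weights is at most |h_i - h_{i-1}| ([id_over_sinh_lipschitz]).  Hence if
    g differs by at most M from an affine function of slope s around x_i, the
    truncation error is at most (q+4)(M + |s| |h_i - h_{i-1}|) ([truncation_error]).
    Only two derivatives of g are involved.

    Derivative bounds.  Let E(x) = exp(-d x/eps) + exp(-d(1-x)/eps) with
    d = sqrt(m)/2.  Differentiating the equation shows that y' and F = f(x,y(x)) solve
    linear equations eps^2 z'' - f_v z = r, with r = O(1) and r = O(eps^2 + E)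
    respectively.  Barrier functions give |y'| <= C(1 + E/eps) and
    |F| <= C(eps^2 + E) ([slope_bound], [rhs_bound]), whence |g'| <= C(1 + E/eps) and
    |g''| <= C(1 + E/eps^2) ([reduced_bounds]).

    Mesh.  By symmetry it suffices to consider the left half, and there the three
    points t-tau, t, t+tau with tau = 1/N.  Put s = p - (t - tau) and
    alpha = p - eps^(1/3).  If t - tau >= alpha, then E = O(eps^2) on the cells while the
    generating function has bounded derivatives.  If t - tau < alpha and s >= 3 tau, the
    derivatives of the generating function are O(eps/s^2) and O(eps/s^3) and E is
    O(s^4).  If t - tau < alpha and s < 3 tau, then eps^(1/3) < 3 tau, hence the steps
    themselves are O(tau^2), and so is E.  In the first two cases g is
    compared with its tangent, in the last one with a constant ([resolved], [mesh_resolved], [affine_approximation]).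
    At t = 1/2 the two steps are equal by symmetry, and if the cells there reach
    below alpha, then N is bounded and boundedness of g suffices. *)

(** * Calculus relative to [0,1] *)

Lemma D_in_of_is_derive (u d : R -> R) (D : R -> Prop) (x : R) :
  is_derive u x (d x) -> D_in u d D x.
Proof.
  intros H; apply (D_in_imp u d no_cond); [easy|].
  apply derivable_pt_lim_D_in, is_derive_Reals, H.
Qed.

(** Composed with this retraction, a function that is differentiable relative to
    [0,1] becomes continuous on the whole line, so that theorems about two-sided
    continuity apply up to the end points. *)
Definition clamp (x : R) : R := Rmax 0 (Rmin 1 x).

Lemma clamp_unit x : unit_interval (clamp x).
Proof.
  unfold clamp, unit_interval, Rmax, Rmin; repeat destruct Rle_dec; lra.
Qed.

Lemma clamp_id x : unit_interval x -> clamp x = x.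
Proof.
  unfold clamp, unit_interval, Rmax, Rmin; repeat destruct Rle_dec; lra.
Qed.

Lemma clamp_lip x z : Rabs (clamp x - clamp z) <= Rabs (x - z).
Proof.
  unfold clamp, Rmax, Rmin; repeat destruct Rle_dec;
    unfold Rabs; repeat destruct Rcase_abs; lra.
Qed.

Lemma continuity_clamp (u d : R -> R) :
  (forall x, unit_interval x -> D_in u d unit_interval x) ->
  forall x, continuity_pt (fun z => u (clamp z)) x.
Proof.
  intros Hu x e He.
  destruct (cont_deriv u d unit_interval (clamp x) (Hu _ (clamp_unit x)) e He)
    as [del [Hdel H]].
  exists del; split; [exact Hdel|].
  intros z [_ Hz]; simpl in *; unfold Rdist in *.
  destruct (Req_dec (clamp z) (clamp x)) as [E|E].
  - rewrite E, Rminus_diag, Rabs_R0; exact He.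
  - apply H; split.
    + split; [apply clamp_unit|congruence].
    + eapply Rle_lt_trans; [apply clamp_lip|exact Hz].
Qed.

Lemma D_in_interior (u d : R -> R) (x : R) :
  0 < x < 1 -> D_in u d unit_interval x -> is_derive (fun z => u (clamp z)) x (d x).
Proof.
  intros Hx Hu. apply is_derive_Reals, derivable_pt_lim_D_in.
  intros e He. destruct (Hu e He) as [del [Hdel H]].
  exists (Rmin del (Rmin x (1 - x))); split.
  { repeat apply Rmin_glb_lt; lra. }
  intros z [[_ Hz1] Hz2]; simpl in *; unfold Rdist in *.
  assert (Hz3 : Rabs (z - x) < del) by (eapply Rlt_le_trans; [apply Hz2|apply Rmin_l]).
  assert (Hz4 : Rabs (z - x) < x).
  { eapply Rlt_le_trans; [apply Hz2|]. eapply Rle_trans; [apply Rmin_r|apply Rmin_l]. }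
  assert (Hz5 : Rabs (z - x) < 1 - x).
  { eapply Rlt_le_trans; [apply Hz2|]. eapply Rle_trans; [apply Rmin_r|apply Rmin_r]. }
  apply Rabs_def2 in Hz4; apply Rabs_def2 in Hz5.
  assert (Uz : unit_interval z) by (unfold unit_interval; lra).
  rewrite (clamp_id z Uz), (clamp_id x) by (unfold unit_interval; lra).
  apply H; repeat split; auto; lra.
Qed.

Lemma mean_value (u d : R -> R) (x z : R) :
  (forall x, unit_interval x -> D_in u d unit_interval x) ->
  unit_interval x -> unit_interval z ->
  exists c, Rmin x z <= c <= Rmax x z /\ u z - u x = d c * (z - x).
Proof.
  intros Hu Hx Hz.
  assert (B : 0 <= Rmin x z /\ Rmax x z <= 1).
  { unfold unit_interval, Rmin, Rmax in *; destruct Rle_dec; lra. }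
  destruct (MVT_gen (fun s => u (clamp s)) x z d) as [c [Hc H]].
  - intros s Hs. apply D_in_interior; [lra|]. apply Hu; unfold unit_interval; lra.
  - intros s _. apply (continuity_clamp u d Hu).
  - exists c; split; [exact Hc|]. rewrite (clamp_id x Hx), (clamp_id z Hz) in H; exact H.
Qed.

Lemma monotone_of_derivative (u d : R -> R) (x z : R) :
  (forall s, unit_interval s -> D_in u d unit_interval s) ->
  0 <= x -> x <= z -> z <= 1 ->
  (forall s, x <= s <= z -> 0 <= d s) -> u x <= u z.
Proof.
  intros Hu Hx Hxz Hz Hd.
  destruct (mean_value u d x z Hu) as [c [Hc E]]; try (unfold unit_interval; lra).
  rewrite Rmin_left, Rmax_right in Hc by lra.
  specialize (Hd c Hc). nra.
Qed.

Lemma taylor2 (u d dd : R -> R) (lo hi M x z : R) :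
  (forall s, unit_interval s -> D_in u d unit_interval s) ->
  (forall s, unit_interval s -> D_in d dd unit_interval s) ->
  0 <= lo -> hi <= 1 ->
  (forall s, lo <= s <= hi -> Rabs (dd s) <= M) ->
  lo <= x <= hi -> lo <= z <= hi ->
  Rabs (u z - u x - d x * (z - x)) <= M * (z - x) ^ 2.
Proof.
  intros Hu Hd Hlo Hhi HM Hx Hz.
  destruct (mean_value u d x z Hu) as [c [Hc E]]; try (unfold unit_interval; lra).
  assert (Hc' : lo <= c <= hi).
  { unfold Rmin, Rmax in Hc; destruct Rle_dec; lra. }
  destruct (mean_value d dd x c Hd) as [c2 [Hc2 E2]]; try (unfold unit_interval; lra).
  assert (Hc2' : lo <= c2 <= hi).
  { unfold Rmin, Rmax in Hc2; destruct Rle_dec; lra. }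
  replace (u z - u x - d x * (z - x)) with (dd c2 * ((c - x) * (z - x)))
    by (rewrite E; replace (d c) with (d x + dd c2 * (c - x)) by lra; ring).
  rewrite Rabs_mult. apply Rmult_le_compat; try apply Rabs_pos; [now apply HM|].
  unfold Rmin, Rmax in Hc; destruct Rle_dec; rewrite Rabs_pos_eq; nra.
Qed.

(** At a negative interior minimum the first derivative vanishes and the second
    one is negative, so the first derivative is negative just to the right and
    the function still decreases there. *)
Lemma maximum_principle (W W1 W2 : R -> R) :
  (forall x, unit_interval x -> D_in W W1 unit_interval x) ->
  (forall x, unit_interval x -> D_in W1 W2 unit_interval x) ->
  0 <= W 0 -> 0 <= W 1 ->
  (forall x, 0 < x < 1 -> W x < 0 -> W2 x < 0) ->
  forall x, unit_interval x -> 0 <= W x.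
Proof.
  intros H1 H2 W0 Wone HW x Hx.
  destruct (continuity_ab_min (fun z => W (clamp z)) 0 1) as [z [Hmin Hz]].
  - lra.
  - intros c _; apply (continuity_clamp W W1 H1).
  - assert (Hmin' : forall c, 0 <= c <= 1 -> W z <= W c).
    { intros c Hc. specialize (Hmin c Hc).
      rewrite (clamp_id c Hc), (clamp_id z Hz) in Hmin; exact Hmin. }
    destruct (Rle_lt_dec 0 (W z)) as [P|P].
    { eapply Rle_trans; [exact P|now apply Hmin']. }
    exfalso.
    assert (Hz' : 0 < z < 1).
    { destruct Hz as [[Hz|Hz] [Hz''|Hz'']]; subst; lra. }
    specialize (HW z Hz' P).
    assert (Ez : W1 z = 0).
    { assert (D := D_in_interior W W1 z Hz' (H1 z Hz)).
      apply is_derive_Reals in D.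
      rewrite <- (derive_pt_eq_0 _ _ _ (exist _ (W1 z) D) D).
      apply (deriv_minimum _ 0 1); try lra.
      intros c Hc1 Hc2. apply Hmin; lra. }
    destruct (H2 z Hz (- W2 z)) as [del [Hdel H]]; [lra|].
    set (s := z + Rmin (del / 2) (1 - z)).
    assert (Hr : 0 < Rmin (del / 2) (1 - z)) by (apply Rmin_glb_lt; lra).
    assert (Hr2 := Rmin_l (del / 2) (1 - z)). assert (Hr3 := Rmin_r (del / 2) (1 - z)).
    assert (Hs : W z <= W s) by (apply Hmin'; unfold s; lra).
    assert (Neg : forall c, z < c <= s -> W1 c < 0).
    { intros b Hb. assert (Q : Rabs ((W1 b - W1 z) / (b - z) - W2 z) < - W2 z).
      { apply H; split; [split; [unfold unit_interval, s in *; lra|lra]|].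
        simpl; unfold Rdist; rewrite Rabs_pos_eq; unfold s in *; lra. }
      apply Rabs_def2 in Q. rewrite Ez, Rminus_0_r in Q.
      destruct Q as [Q _]. assert (Q' : W1 b / (b - z) < 0) by lra.
      replace (W1 b) with (W1 b / (b - z) * (b - z)) by (field; lra). nra. }
    set (b := (z + s) / 2).
    destruct (mean_value W W1 b s H1) as [c' [Hc' E']];
      try (unfold b, s, unit_interval; lra).
    rewrite Rmin_left, Rmax_right in Hc' by (unfold b, s; lra).
    assert (W1 c' < 0) by (apply Neg; unfold b, s in *; lra).
    assert (W s < W b) by (unfold b, s in *; nra).
    assert (W b <= W z).
    { assert (- W z <= - W b); [|lra].
      apply (monotone_of_derivative (fun t => - W t) (fun t => - W1 t));
        try (unfold b, s; lra).
      - intros t Ht. apply Dopp, H1, Ht.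
      - intros t Ht. destruct (proj1 Ht) as [Ht'|<-]; [|lra].
        assert (W1 t < 0); [apply Neg; unfold b, s in *; lra|lra]. }
    lra.
Qed.

(** * Functions on the strip *)

Definition on_strip (h : R -> R -> R) : Prop :=
  continuous_on strip (fun z : R * R => h (fst z) (snd z)).

Lemma on_strip_eps (h : R -> R -> R) (x v e : R) :
  on_strip h -> unit_interval x -> 0 < e ->
  exists d, 0 < d /\ forall s w, unit_interval s ->
    Rabs (s - x) < d -> Rabs (w - v) < d -> Rabs (h s w - h x v) < e.
Proof.
  intros Hh Hx He.
  pose proof (proj1 (filterlim_locally _ _) (Hh (x, v) Hx) (mkposreal e He)) as [d Hd].
  exists d; split; [apply cond_pos|].
  intros s w Hs H1 H2. apply (Hd (s, w)); [split; [exact H1|exact H2]|exact Hs].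
Qed.

(** Each point has a neighbourhood in which the values differ by less than 1 from
    the value at that point, and finitely many of them cover the rectangle. *)
Lemma bounded_on_rectangle (h : R -> R -> R) (Y : R) :
  on_strip h ->
  exists B, forall x v, unit_interval x -> Rabs v <= Y -> Rabs (h x v) <= B.
Proof.
  intros Hh.
  assert (ex : forall x v : R, {d : posreal | unit_interval x -> forall s w,
    unit_interval s -> Rabs (s - x) < d -> Rabs (w - v) < d ->
    Rabs (h s w - h x v) < 1}).
  { intros x v. apply constructive_indefinite_description.
    destruct (Rle_dec 0 x) as [H0|H0]; [destruct (Rle_dec x 1) as [H1|H1]|].
    - destruct (on_strip_eps h x v 1 Hh (conj H0 H1) Rlt_0_1) as [d [Hd H]].
      now exists (mkposreal d Hd).
    - exists (mkposreal 1 Rlt_0_1). intros [_ H]; contradiction.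
    - exists (mkposreal 1 Rlt_0_1). intros [H _]; contradiction. }
  set (delta := fun t : Tn 2 R => proj1_sig (ex (fst t) (fst (snd t)))).
  destruct (NNPP _
    (compactness_list 2 (0, (- Y, tt)) (1, (Y, tt)) delta)) as [l Hl].
  set (B := fold_right (fun (t : Tn 2 R) b => Rmax (Rabs (h (fst t) (fst (snd t)))) b) 0 l).
  exists (B + 1). intros x v Hx Hv.
  assert (Hv' : - Y <= v <= Y).
  { pose proof (Rle_abs v). pose proof (Rle_abs (- v)). rewrite Rabs_Ropp in *. lra. }
  destruct (Hl (x, (v, tt))) as [[t1 [t2 []]] [Ht [Hb Hc]]].
  { simpl; repeat split; auto; apply Hx || apply Hv'. }
  simpl in Hb, Hc. unfold delta in Hc; simpl in Hc.
  destruct (ex t1 t2) as [d Hd]; simpl in Hc.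
  assert (Hclose : Rabs (h x v - h t1 t2) < 1) by (apply Hd; try apply Hc; auto; apply Hb).
  assert (HB : Rabs (h t1 t2) <= B).
  { clear - Ht. unfold B; clear B. induction l as [|a l IH]; [destruct Ht|].
    simpl. destruct Ht as [->|Ht].
    - apply Rmax_l.
    - eapply Rle_trans; [apply IH, Ht|apply Rmax_r]. }
  pose proof (Rabs_triang (h x v - h t1 t2) (h t1 t2)) as T.
  replace (h x v - h t1 t2 + h t1 t2) with (h x v) in T by ring. lra.
Qed.

Definition partials (h hx hv : R -> R -> R) : Prop :=
  forall x v, unit_interval x ->
    D_in (fun s => h s v) (fun s => hx s v) unit_interval x /\
    is_derive (h x) v (hv x v).

(** The increment is split into a move in x followed by a move in v. The first
    one is handled by the mean value theorem, at whose intermediate point the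
    joint continuity of the x-derivative enters. *)
Lemma chain_rule (h hx hv : R -> R -> R) (y y1 : R -> R) (x : R) :
  partials h hx hv -> on_strip hx ->
  unit_interval x -> D_in y y1 unit_interval x ->
  D_in (fun s => h s (y s)) (fun s => hx s (y s) + hv s (y s) * y1 s) unit_interval x.
Proof.
  intros Hp Hc Hx Hy.
  assert (Hv : D_in (fun s => h x (y s)) (fun s => hv x (y s) * y1 s) unit_interval x).
  { apply (D_in_ext (fun s => y1 s * hv x (y s))); [ring|].
    apply (D_in_imp _ _ (Dgf unit_interval no_cond y)).
    - intros s Hs; split; [exact Hs|exact I].
    - apply (Dcomp unit_interval no_cond y1 (hv x) y (h x)); [exact Hy|].
      apply derivable_pt_lim_D_in, is_derive_Reals, Hp, Hx. }
  intros e He.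
  destruct (Hv (e / 2)) as [d1 [Hd1 H1]]; [lra|].
  destruct (on_strip_eps hx x (y x) (e / 2) Hc Hx) as [d2 [Hd2 H2]]; [lra|].
  destruct (cont_deriv y y1 unit_interval x Hy d2 Hd2) as [d3 [Hd3 H3]].
  exists (Rmin d1 (Rmin d2 d3)); split.
  { repeat apply Rmin_glb_lt; lra. }
  intros z [[Uz Nz] Hz].
  assert (B1 := Rmin_l d1 (Rmin d2 d3)). assert (B2 := Rmin_r d1 (Rmin d2 d3)).
  assert (B3 := Rmin_l d2 d3). assert (B4 := Rmin_r d2 d3).
  simpl in *; unfold Rdist in *.
  assert (Q1 := H1 z (conj (conj Uz Nz) (Rlt_le_trans _ _ _ Hz B1))).
  assert (Q3 : Rabs (y z - y x) < d2) by (apply H3; split; [split; auto|lra]).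
  destruct (mean_value (fun s => h s (y z)) (fun s => hx s (y z)) x z) as [c [Hc' E]]; auto.
  { intros s Hs. apply Hp, Hs. }
  assert (Uc : unit_interval c).
  { clear - Hc' Hx Uz; unfold unit_interval, Rmin, Rmax in *; destruct Rle_dec; lra. }
  assert (Q2 : Rabs (hx c (y z) - hx x (y x)) < e / 2).
  { apply H2; auto. apply Rle_lt_trans with (Rabs (z - x)); [|lra].
    clear - Hc'; unfold Rmin, Rmax in Hc'; destruct Rle_dec;
      unfold Rabs; repeat destruct Rcase_abs; lra. }
  replace ((h z (y z) - h x (y x)) / (z - x) - (hx x (y x) + hv x (y x) * y1 x))
    with ((hx c (y z) - hx x (y x))
          + ((h x (y z) - h x (y x)) / (z - x) - hv x (y x) * y1 x)).
  - eapply Rle_lt_trans; [apply Rabs_triang|]. lra.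
  - replace (h z (y z)) with (h x (y z) + hx c (y z) * (z - x)) by lra. field. lra.
Qed.

(** * Bounds for the solution and its derivatives *)

Definition layer (d eps x : R) : R := exp (- (d * x / eps)) + exp (- (d * (1 - x) / eps)).

Definition layer1 (d eps x : R) : R :=
  d / eps * (exp (- (d * (1 - x) / eps)) - exp (- (d * x / eps))).

Lemma layer_pos d eps x : 0 < layer d eps x.
Proof. unfold layer. pose proof (exp_pos (- (d * x / eps))).
  pose proof (exp_pos (- (d * (1 - x) / eps))). lra. Qed.

Lemma layer_sym d eps x : layer d eps (1 - x) = layer d eps x.
Proof. unfold layer. replace (1 - (1 - x)) with x by ring. ring. Qed.

Lemma exp_neg_le_1 x : 0 <= x -> exp (- x) <= 1.
Proof. intros H. rewrite <- exp_0. destruct H as [H|<-].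
  - left; apply exp_increasing; lra.
  - right; f_equal; ring. Qed.

Lemma layer_le_2 d eps x : 0 < d -> 0 < eps -> unit_interval x -> layer d eps x <= 2.
Proof.
  intros Hd He [H0 H1]. unfold layer.
  assert (exp (- (d * x / eps)) <= 1).
  { apply exp_neg_le_1. apply Rdiv_le_0_compat; nra. }
  assert (exp (- (d * (1 - x) / eps)) <= 1).
  { apply exp_neg_le_1. apply Rdiv_le_0_compat; nra. }
  lra.
Qed.

Lemma layer_0_1 d eps : 1 <= layer d eps 0 /\ 1 <= layer d eps 1.
Proof.
  unfold layer. replace (- (d * 0 / eps)) with 0 by (unfold Rdiv; ring).
  replace (- (d * (1 - 1) / eps)) with 0 by (unfold Rdiv; ring).
  rewrite exp_0. pose proof (exp_pos (- (d * (1 - 0) / eps))).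
  pose proof (exp_pos (- (d * 1 / eps))). lra.
Qed.

Lemma layer_derive d eps x : eps <> 0 -> is_derive (layer d eps) x (layer1 d eps x).
Proof.
  intros He. unfold layer, layer1. auto_derive; [easy|].
  unfold Rdiv, Rminus; field; auto.
Qed.

Lemma layer1_derive d eps x :
  eps <> 0 -> is_derive (layer1 d eps) x (d ^ 2 / eps ^ 2 * layer d eps x).
Proof.
  intros He. unfold layer, layer1. auto_derive; [easy|].
  unfold Rdiv, Rminus; field; auto.
Qed.

Lemma Rabs_le_of_signs A v :
  (forall s, s = 1 \/ s = -1 -> 0 <= A + s * v) -> Rabs v <= A.
Proof.
  intros H. pose proof (H 1 (or_introl eq_refl)). pose proof (H (-1) (or_intror eq_refl)).
  apply Rabs_le; lra.
Qed.

(** Wherever B + z or B - z is negative, the inequality makes its second derivative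
    negative, so the maximum principle applies to both. The coefficient c may be
    chosen point by point, which covers linearised and nonlinear equations alike. *)
Lemma barrier (eps : R) (z z1 z2 B B1 B2 : R -> R) :
  0 < eps ->
  (forall x, unit_interval x -> D_in z z1 unit_interval x) ->
  (forall x, unit_interval x -> D_in z1 z2 unit_interval x) ->
  (forall x, unit_interval x -> D_in B B1 unit_interval x) ->
  (forall x, unit_interval x -> D_in B1 B2 unit_interval x) ->
  Rabs (z 0) <= B 0 -> Rabs (z 1) <= B 1 ->
  (forall x, unit_interval x -> exists c, 0 < c /\
     Rabs (eps ^ 2 * z2 x - c * z x) <= c * B x - eps ^ 2 * B2 x) ->
  forall x, unit_interval x -> Rabs (z x) <= B x.
Proof.
  intros He Hz Hz1 HB HB1 H0 H1 H x Hx. apply Rabs_le_of_signs. intros s Hs.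
  revert x Hx.
  apply (maximum_principle _ (fun x => B1 x + s * z1 x) (fun x => B2 x + s * z2 x)).
  - intros x Hx. apply Dadd; [auto|]. apply (Dmult_const _ z z1); auto.
  - intros x Hx. apply Dadd; [auto|]. apply (Dmult_const _ z1 z2); auto.
  - apply Rabs_le_between in H0. destruct Hs; subst; lra.
  - apply Rabs_le_between in H1. destruct Hs; subst; lra.
  - intros x Hx HW. destruct (H x) as [c [Hc Hr]]; [unfold unit_interval; lra|].
    apply Rabs_le_between in Hr.
    assert (E : eps ^ 2 * (B2 x + s * z2 x) <= c * (B x + s * z x))
      by (destruct Hs; subst; lra).
    assert (P : 0 < eps ^ 2) by (apply pow_lt; lra).
    assert (c * (B x + s * z x) < 0) by nra. nra.
Qed.

Lemma increment_in_v (f fv : R -> R -> R) (m gamma x v w : R) :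
  (forall v, is_derive (f x) v (fv x v)) ->
  (forall v, m <= fv x v <= gamma) ->
  exists c, m <= c <= gamma /\ f x v - f x w = c * (v - w).
Proof.
  intros Hd Hb.
  destruct (MVT_gen (f x) w v (fv x)) as [c [_ E]].
  - intros s _; apply Hd.
  - intros s _. apply derivable_continuous_pt. exists (fv x s). apply is_derive_Reals, Hd.
  - exists (fv x c); split; [apply Hb|exact E].
Qed.

Section Solution.

Variables (f fx fv fxx fxv fvx fvv : R -> R -> R) (m gamma d : R).

Record smooth_monotone : Prop := {
  sm_f : partials f fx fv;
  sm_fx : partials fx fxx fxv;
  sm_fv : partials fv fvx fvv;
  sm_cf : on_strip f;
  sm_cfx : on_strip fx;
  sm_cfv : on_strip fv;
  sm_cfxx : on_strip fxx;
  sm_cfxv : on_strip fxv;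
  sm_cfvx : on_strip fvx;
  sm_cfvv : on_strip fvv;
  sm_m : 0 < m;
  sm_fv_bounds : forall x v, unit_interval x -> m <= fv x v <= gamma }.

(** The second derivative is eliminated by the equation, which makes it evident
    that it can be differentiated twice more. *)
Record solution (eps : R) (y y1 : R -> R) : Prop := {
  sol_eps : 0 < eps < 1;
  sol_y : forall x, unit_interval x -> D_in y y1 unit_interval x;
  sol_y1 : forall x, unit_interval x ->
    D_in y1 (fun s => / eps ^ 2 * f s (y s)) unit_interval x;
  sol_0 : y 0 = 0;
  sol_1 : y 1 = 0 }.

Definition rhs1 (y y1 : R -> R) (x : R) : R := fx x (y x) + fv x (y x) * y1 x.

(** The part of the second derivative of f(x,y(x)) that does not contain y''. *)
Definition rhs2_low (y y1 : R -> R) (x : R) : R :=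
  fxx x (y x) + fxv x (y x) * y1 x + (fvx x (y x) + fvv x (y x) * y1 x) * y1 x.

Definition rhs2 (eps : R) (y y1 : R -> R) (x : R) : R :=
  rhs2_low y y1 x + fv x (y x) * (/ eps ^ 2 * f x (y x)).

Hypothesis HS : smooth_monotone.
Hypothesis Hd : 0 < d.
Hypothesis Hdm : 4 * d ^ 2 = m.

Lemma rhs_derive eps y y1 x :
  solution eps y y1 -> unit_interval x ->
  D_in (fun s => f s (y s)) (rhs1 y y1) unit_interval x.
Proof.
  intros Y Hx. apply (chain_rule f fx fv); auto; try apply HS. apply Y, Hx.
Qed.

Lemma rhs1_derive eps y y1 x :
  solution eps y y1 -> unit_interval x ->
  D_in (rhs1 y y1) (rhs2 eps y y1) unit_interval x.
Proof.
  intros Y Hx. unfold rhs1. eapply D_in_ext; [|apply Dadd; [|apply Dmult]].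
  2:{ apply (chain_rule fx fxx fxv y y1); auto; try apply HS. apply Y, Hx. }
  2:{ apply (chain_rule fv fvx fvv y y1); auto; try apply HS. apply Y, Hx. }
  2:{ apply Y, Hx. }
  unfold rhs2, rhs2_low. simpl. ring.
Qed.

(** The mean value theorem in v turns the equation into
    eps^2 y'' - c y = f(x,0) with c >= m, for which a constant is a barrier. *)
Lemma solution_bounded :
  exists Y0, forall eps y y1, solution eps y y1 ->
    forall x, unit_interval x -> Rabs (y x) <= Y0.
Proof.
  destruct (bounded_on_rectangle f 0 (sm_cf HS)) as [B HB].
  assert (Hm := sm_m HS).
  exists (B / m). intros eps y y1 Y.
  assert (B0 : 0 <= B / m).
  { assert (0 <= B); [|apply Rdiv_le_0_compat; lra].
    eapply Rle_trans; [apply Rabs_pos|apply (HB 0 0)]; [unfold unit_interval; lra|].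
    rewrite Rabs_R0; lra. }
  destruct (sol_eps _ _ _ Y) as [He He1].
  apply (barrier eps y y1 (fun s => / eps ^ 2 * f s (y s)) (fun _ => B / m) (fun _ => 0) (fun _ => 0) He).
  - apply Y.
  - apply Y.
  - intros; apply Dconst.
  - intros; apply Dconst.
  - rewrite (sol_0 _ _ _ Y), Rabs_R0; exact B0.
  - rewrite (sol_1 _ _ _ Y), Rabs_R0; exact B0.
  - intros x Hx. destruct (increment_in_v f fv m gamma x (y x) 0) as [c [Hc E]].
    { intros v; apply (sm_f HS), Hx. }
    { intros v; apply (sm_fv_bounds HS), Hx. }
    exists c; split; [lra|].
    replace (eps ^ 2 * (/ eps ^ 2 * f x (y x)) - c * y x) with (f x 0)
      by (field_simplify; lra).
    rewrite Rmult_0_r, Rminus_0_r.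
    eapply Rle_trans; [apply HB; [exact Hx|rewrite Rabs_R0; lra]|].
    apply Rle_trans with (m * (B / m)); [right; field; lra|nra].
Qed.

Lemma bounds_along_solutions (h : R -> R -> R) :
  on_strip h ->
  exists B, 0 < B /\ forall eps y y1, solution eps y y1 ->
    forall x, unit_interval x -> Rabs (h x (y x)) <= B.
Proof.
  intros Hh. destruct solution_bounded as [Y0 HY].
  destruct (bounded_on_rectangle h Y0 Hh) as [B HB].
  exists (Rmax B 1); split; [eapply Rlt_le_trans; [|apply Rmax_r]; lra|].
  intros eps y y1 Y x Hx. eapply Rle_trans; [|apply Rmax_l].
  apply HB; [exact Hx|]. now apply (HY eps y y1).
Qed.

(** Over a distance eps the slope changes by O(1/eps), and somewhere on the way
    it is O(1/eps) because the solution is bounded. *)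
Lemma slope_crude :
  exists B, 0 < B /\ forall eps y y1, solution eps y y1 ->
    forall x, unit_interval x -> Rabs (y1 x) <= B / eps.
Proof.
  destruct solution_bounded as [Y0 HY].
  destruct (bounds_along_solutions f (sm_cf HS)) as [B [HB0 HB]].
  exists (4 * Rabs Y0 + B). split; [pose proof (Rabs_pos Y0); lra|].
  intros eps y y1 Y x Hx. destruct (sol_eps _ _ _ Y) as [He He1].
  (* A point of [0,1] at distance eps / 2 from x exists on one of the sides. *)
  assert (Z : exists z, unit_interval z /\ Rabs (z - x) = eps / 2).
  { unfold unit_interval in *. destruct (Rle_dec x (1 / 2)).
    - exists (x + eps / 2); split; [lra|]. rewrite Rabs_pos_eq; lra.
    - exists (x - eps / 2); split; [lra|]. rewrite Rabs_left; lra. }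
  destruct Z as [z [Uz Hz]].
  destruct (mean_value y y1 x z) as [c [Hc E]]; auto; [apply Y|].
  assert (Uc : unit_interval c).
  { clear - Hc Hx Uz. unfold unit_interval, Rmin, Rmax in *; destruct Rle_dec; lra. }
  destruct (mean_value y1 _ x c (sol_y1 _ _ _ Y)) as [c' [Hc' E']]; auto.
  assert (Uc' : unit_interval c').
  { clear - Hc' Hx Uc. unfold unit_interval, Rmin, Rmax in *; destruct Rle_dec; lra. }
  assert (Hcx : Rabs (c - x) <= eps / 2).
  { rewrite <- Hz. clear - Hc. unfold Rmin, Rmax in Hc; destruct Rle_dec;
      unfold Rabs; repeat destruct Rcase_abs; lra. }
  assert (Q1 : Rabs (y1 c) <= 4 * Rabs Y0 / eps).
  { assert (H : Rabs (y z - y x) <= 2 * Rabs Y0).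
    { eapply Rle_trans; [apply Rabs_triang|]. rewrite Rabs_Ropp.
      pose proof (HY _ _ _ Y z Uz). pose proof (HY _ _ _ Y x Hx).
      pose proof (Rle_abs Y0). lra. }
    rewrite E, Rabs_mult, Hz in H.
    apply Rmult_le_reg_r with (eps / 2); [lra|].
    eapply Rle_trans; [exact H|right; field; lra]. }
  assert (Q2 : Rabs (y1 c - y1 x) <= B / eps).
  { rewrite E', Rabs_mult. apply Rle_trans with (B / eps ^ 2 * (eps / 2)).
    - apply Rmult_le_compat; auto using Rabs_pos.
      unfold Rdiv. rewrite Rabs_mult, Rabs_inv, (Rabs_pos_eq (eps ^ 2)), Rmult_comm by nra.
      apply Rmult_le_compat_r; [left; apply Rinv_0_lt_compat; nra|].
      apply (HB _ _ _ Y c' Uc').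
    - replace (B / eps ^ 2 * (eps / 2)) with (B / eps * / 2) by (field; lra).
      assert (0 < B / eps) by (apply Rdiv_lt_0_compat; lra). lra. }
  replace (y1 x) with (y1 c - (y1 c - y1 x)) by ring.
  eapply Rle_trans; [apply Rabs_triang|]. rewrite Rabs_Ropp.
  replace ((4 * Rabs Y0 + B) / eps) with (4 * Rabs Y0 / eps + B / eps) by (field; lra).
  lra.
Qed.

Lemma layer_D_in eps x : 0 < eps ->
  D_in (layer d eps) (layer1 d eps) unit_interval x.
Proof. intros He; apply D_in_of_is_derive, layer_derive; lra. Qed.

Lemma layer1_D_in eps x : 0 < eps ->
  D_in (layer1 d eps) (fun x => d ^ 2 / eps ^ 2 * layer d eps x) unit_interval x.
Proof. intros He. apply D_in_of_is_derive, layer1_derive; lra. Qed.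

(** The slope satisfies eps^2 z'' = f_x + f_v z, so a constant takes care of
    f_x and a multiple of the layer function of the values at the end points. *)
Lemma slope_bound :
  exists A, 0 < A /\ forall eps y y1, solution eps y y1 ->
    forall x, unit_interval x -> Rabs (y1 x) <= A * (1 + layer d eps x / eps).
Proof.
  assert (Hm := sm_m HS).
  destruct slope_crude as [A1 [PA1 HA1]].
  destruct (bounds_along_solutions fx (sm_cfx HS)) as [B [PB HB]].
  assert (PBm : 0 < B / m) by (apply Rdiv_lt_0_compat; lra).
  exists (B / m + A1). split; [lra|].
  intros eps y y1 Y. destruct (sol_eps _ _ _ Y) as [He He1].
  assert (PA : 0 < A1 / eps) by (apply Rdiv_lt_0_compat; lra).
  assert (G : forall x, unit_interval x ->
    Rabs (y1 x) <= B / m + A1 / eps * layer d eps x).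
  { apply (barrier eps y1 (fun s => / eps ^ 2 * f s (y s))
      (fun s => / eps ^ 2 * rhs1 y y1 s)
      _ (fun x => A1 / eps * layer1 d eps x)
      (fun x => A1 / eps * (d ^ 2 / eps ^ 2 * layer d eps x)) He).
    - apply Y.
    - intros x Hx.
      apply (Dmult_const _ (fun s => f s (y s)) (rhs1 y y1)).
      now apply (rhs_derive eps).
    - intros x Hx. apply (D_in_ext (fun x => 0 + A1 / eps * layer1 d eps x)); [ring|].
      apply Dadd; [apply Dconst|]. apply (Dmult_const _ (layer d eps) (layer1 d eps)).
      now apply layer_D_in.
    - intros x Hx.
      apply (Dmult_const _ (layer1 d eps) (fun x => d ^ 2 / eps ^ 2 * layer d eps x)).
      now apply layer1_D_in.
    - eapply Rle_trans; [apply (HA1 _ _ _ Y); unfold unit_interval; lra|].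
      pose proof (layer_0_1 d eps). nra.
    - eapply Rle_trans; [apply (HA1 _ _ _ Y); unfold unit_interval; lra|].
      pose proof (layer_0_1 d eps). nra.
    - intros x Hx. exists (fv x (y x)).
      pose proof (sm_fv_bounds HS x (y x) Hx) as Hc. split; [lra|].
      replace (eps ^ 2 * (/ eps ^ 2 * rhs1 y y1 x) - fv x (y x) * y1 x) with (fx x (y x))
        by (unfold rhs1; field; lra).
      replace (eps ^ 2 * (A1 / eps * (d ^ 2 / eps ^ 2 * layer d eps x)))
        with (d ^ 2 * (A1 / eps * layer d eps x)) by (field; lra).
      pose proof (HB _ _ _ Y x Hx) as HBx.
      pose proof (Rmult_lt_0_compat _ _ PA (layer_pos d eps x)) as PL.
      apply Rle_trans with (m * (B / m)); [replace (m * (B / m)) with B by (field; lra); lra|].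
      nra. }
  intros x Hx. eapply Rle_trans; [apply G, Hx|].
  pose proof (layer_pos d eps x).
  assert (0 < layer d eps x / eps) by (apply Rdiv_lt_0_compat; lra).
  replace (A1 / eps * layer d eps x) with (A1 * (layer d eps x / eps)) by (field; lra).
  nra.
Qed.

Lemma rhs1_bound :
  exists A, 0 < A /\ forall eps y y1, solution eps y y1 ->
    forall x, unit_interval x -> Rabs (rhs1 y y1 x) <= A * (1 + layer d eps x / eps).
Proof.
  destruct slope_bound as [A [PA HA]].
  destruct (bounds_along_solutions fx (sm_cfx HS)) as [B [PB HB]].
  destruct (bounds_along_solutions fv (sm_cfv HS)) as [B' [PB' HB']].
  exists (B + B' * A). split; [nra|].
  intros eps y y1 Y x Hx. destruct (sol_eps _ _ _ Y) as [He He1].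
  specialize (HA _ _ _ Y x Hx). specialize (HB _ _ _ Y x Hx). specialize (HB' _ _ _ Y x Hx).
  assert (PL : 0 < layer d eps x / eps) by (apply Rdiv_lt_0_compat; auto using layer_pos).
  unfold rhs1. eapply Rle_trans; [apply Rabs_triang|]. rewrite Rabs_mult.
  assert (Rabs (fv x (y x)) * Rabs (y1 x) <= B' * (A * (1 + layer d eps x / eps)))
    by (apply Rmult_le_compat; auto using Rabs_pos).
  nra.
Qed.

(** The square of the slope enters, but the layer function is at most 2, so its
    square costs only a factor. *)
Lemma rhs2_low_bound :
  exists A, 0 < A /\ forall eps y y1, solution eps y y1 ->
    forall x, unit_interval x ->
      Rabs (rhs2_low y y1 x) <= A * (1 + layer d eps x / eps ^ 2).
Proof.
  destruct slope_bound as [A [PA HA]].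
  destruct (bounds_along_solutions fxx (sm_cfxx HS)) as [B1 [PB1 HB1]].
  destruct (bounds_along_solutions fxv (sm_cfxv HS)) as [B2 [PB2 HB2]].
  destruct (bounds_along_solutions fvx (sm_cfvx HS)) as [B3 [PB3 HB3]].
  destruct (bounds_along_solutions fvv (sm_cfvv HS)) as [B4 [PB4 HB4]].
  exists (B1 + B2 * A + B3 * A + 4 * (B4 * (A * A))).
  assert (0 < B2 * A) by nra. assert (0 < B3 * A) by nra.
  assert (0 < B4 * (A * A)) by (repeat apply Rmult_lt_0_compat; lra).
  split; [nra|].
  intros eps y y1 Y x Hx. destruct (sol_eps _ _ _ Y) as [He He1].
  specialize (HA _ _ _ Y x Hx). specialize (HB1 _ _ _ Y x Hx). specialize (HB2 _ _ _ Y x Hx).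
  specialize (HB3 _ _ _ Y x Hx). specialize (HB4 _ _ _ Y x Hx).
  set (L := layer d eps x / eps) in *.
  assert (PL : 0 < L) by (apply Rdiv_lt_0_compat; auto using layer_pos).
  set (Q := layer d eps x / eps ^ 2).
  assert (QL : L <= Q).
  { unfold L, Q. replace (layer d eps x / eps) with (layer d eps x / eps ^ 2 * eps)
      by (field; lra).
    assert (0 < layer d eps x / eps ^ 2) by (apply Rdiv_lt_0_compat; [apply layer_pos|nra]).
    nra. }
  assert (QL2 : L * L <= 2 * Q).
  { unfold L, Q. replace (layer d eps x / eps * (layer d eps x / eps))
      with (layer d eps x * (layer d eps x / eps ^ 2)) by (field; lra).
    pose proof (layer_le_2 d eps x Hd He Hx).
    assert (0 < layer d eps x / eps ^ 2) by (apply Rdiv_lt_0_compat; [apply layer_pos|nra]).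
    nra. }
  unfold rhs2_low.
  set (Z := Rabs (y1 x)) in *.
  assert (PZ : 0 <= Z) by apply Rabs_pos.
  apply Rle_trans with (B1 + B2 * Z + (B3 + B4 * Z) * Z).
  { eapply Rle_trans; [apply Rabs_triang|]. apply Rplus_le_compat.
    - eapply Rle_trans; [apply Rabs_triang|]. rewrite Rabs_mult.
      apply Rplus_le_compat; auto. now apply Rmult_le_compat_r.
    - rewrite Rabs_mult. apply Rmult_le_compat_r; auto.
      eapply Rle_trans; [apply Rabs_triang|]. rewrite Rabs_mult.
      apply Rplus_le_compat; auto. now apply Rmult_le_compat_r. }
  assert (Z <= A * (1 + Q)) by nra.
  assert (Z * Z <= A * A * (4 * (1 + Q))).
  { apply Rle_trans with ((A * (1 + L)) * (A * (1 + L))).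
    - apply Rmult_le_compat; auto.
    - replace ((A * (1 + L)) * (A * (1 + L))) with (A * A * ((1 + L) * (1 + L))) by ring.
      apply Rmult_le_compat_l; nra. }
  assert (B2 * Z <= B2 * (A * (1 + Q))) by (apply Rmult_le_compat_l; lra).
  assert (B3 * Z <= B3 * (A * (1 + Q))) by (apply Rmult_le_compat_l; lra).
  assert (B4 * (Z * Z) <= B4 * (A * A * (4 * (1 + Q)))) by (apply Rmult_le_compat_l; lra).
  assert (B1 <= B1 * (1 + Q)) by nra.
  nra.
Qed.

(** The function F(x) = f(x,y(x)), which is eps^2 y'', solves
    eps^2 F'' = f_v F + O(eps^2 + layer). The barrier is of the same form because
    eps^2 layer'' = d^2 layer with d^2 below m. This replaces the usual
    comparison with the solution of the reduced problem f(x,u) = 0. *)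
Lemma rhs_bound :
  exists A, 0 < A /\ forall eps y y1, solution eps y y1 ->
    forall x, unit_interval x -> Rabs (f x (y x)) <= A * (eps ^ 2 + layer d eps x).
Proof.
  assert (Hm := sm_m HS).
  destruct rhs2_low_bound as [A [PA HA]].
  destruct (bounds_along_solutions f (sm_cf HS)) as [B [PB HB]].
  assert (PAm : 0 < A / m) by (apply Rdiv_lt_0_compat; lra).
  exists (2 * (A / m) + B). split; [lra|].
  intros eps y y1 Y. destruct (sol_eps _ _ _ Y) as [He He1].
  set (b := 2 * (A / m) + B).
  intros x0 Hx0.
  replace (b * (eps ^ 2 + layer d eps x0)) with (b * eps ^ 2 + b * layer d eps x0) by ring.
  revert x0 Hx0.
  apply (barrier eps (fun s => f s (y s)) (rhs1 y y1) (rhs2 eps y y1)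
      (fun x => b * eps ^ 2 + b * layer d eps x) (fun x => b * layer1 d eps x)
      (fun x => b * (d ^ 2 / eps ^ 2 * layer d eps x)) He).
  - intros x Hx. now apply (rhs_derive eps).
  - intros x Hx. now apply rhs1_derive.
  - intros x Hx. apply (D_in_ext (fun x => 0 + b * layer1 d eps x)); [ring|].
    apply Dadd; [apply Dconst|]. apply (Dmult_const _ (layer d eps) (layer1 d eps)).
    now apply layer_D_in.
  - intros x Hx.
    apply (Dmult_const _ (layer1 d eps) (fun x => d ^ 2 / eps ^ 2 * layer d eps x)).
    now apply layer1_D_in.
  - eapply Rle_trans; [apply (HB _ _ _ Y); unfold unit_interval; lra|].
    pose proof (layer_0_1 d eps). unfold b; nra.
  - eapply Rle_trans; [apply (HB _ _ _ Y); unfold unit_interval; lra|].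
    pose proof (layer_0_1 d eps). unfold b; nra.
  - intros x Hx. exists (fv x (y x)).
    pose proof (sm_fv_bounds HS x (y x) Hx) as Hc. split; [lra|].
    replace (eps ^ 2 * rhs2 eps y y1 x - fv x (y x) * f x (y x))
      with (eps ^ 2 * rhs2_low y y1 x) by (unfold rhs2; field; lra).
    replace (eps ^ 2 * (b * (d ^ 2 / eps ^ 2 * layer d eps x)))
      with (d ^ 2 * (b * layer d eps x)) by (field; lra).
    pose proof (layer_pos d eps x) as PL.
    assert (Pe : 0 < eps ^ 2) by nra.
    rewrite Rabs_mult, (Rabs_pos_eq (eps ^ 2)) by lra.
    apply Rle_trans with (A * (eps ^ 2 + layer d eps x)).
    + apply Rle_trans with (eps ^ 2 * (A * (1 + layer d eps x / eps ^ 2))).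
      * apply Rmult_le_compat_l; [lra|]. now apply (HA eps).
      * right; field; lra.
    + set (T := eps ^ 2) in *. set (L := layer d eps x) in *.
      assert (2 * A <= m * b).
      { unfold b. replace (m * (2 * (A / m) + B)) with (2 * A + m * B) by (field; lra). nra. }
      assert (0 < b) by (unfold b; lra).
      assert (m * (b * T) <= fv x (y x) * (b * T)) by (apply Rmult_le_compat_r; nra).
      assert (m * (b * L) <= fv x (y x) * (b * L)) by (apply Rmult_le_compat_r; nra).
      assert (2 * A * T <= m * b * T) by (apply Rmult_le_compat_r; lra).
      assert (2 * A * L <= m * b * L) by (apply Rmult_le_compat_r; lra).
      nra.
Qed.

(** The truncation error depends on y only through this function, which is
    gamma y - eps^2 y''. *)
Definition reduced (y : R -> R) (x : R) : R := gamma * y x - f x (y x).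

Definition reduced1 (y y1 : R -> R) (x : R) : R := gamma * y1 x - rhs1 y y1 x.

Definition reduced2 (eps : R) (y y1 : R -> R) (x : R) : R :=
  gamma * (/ eps ^ 2 * f x (y x)) - rhs2 eps y y1 x.

Lemma reduced_derive eps y y1 x :
  solution eps y y1 -> unit_interval x ->
  D_in (reduced y) (reduced1 y y1) unit_interval x /\
  D_in (reduced1 y y1) (reduced2 eps y y1) unit_interval x.
Proof.
  intros Y Hx. unfold reduced, reduced1, reduced2; split; apply Dminus.
  - apply (Dmult_const _ y y1), Y, Hx.
  - now apply (rhs_derive eps).
  - apply (Dmult_const _ y1 (fun s => / eps ^ 2 * f s (y s))), Y, Hx.
  - now apply rhs1_derive.
Qed.

Lemma gamma_pos : 0 < gamma.
Proof.
  pose proof (sm_m HS).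
  assert (U : unit_interval 0) by (unfold unit_interval; lra).
  pose proof (sm_fv_bounds HS 0 0 U). lra.
Qed.

Lemma reduced_bounds :
  exists A, 0 < A /\ forall eps y y1, solution eps y y1 ->
    forall x, unit_interval x ->
      Rabs (reduced1 y y1 x) <= A * (1 + layer d eps x / eps) /\
      Rabs (reduced2 eps y y1 x) <= A * (1 + layer d eps x / eps ^ 2).
Proof.
  assert (Hg := gamma_pos). assert (Hm := sm_m HS).
  destruct slope_bound as [A1 [PA1 HA1]].
  destruct rhs1_bound as [A2 [PA2 HA2]].
  destruct rhs2_low_bound as [A3 [PA3 HA3]].
  destruct rhs_bound as [A4 [PA4 HA4]].
  assert (0 < gamma * A1) by nra. assert (0 < gamma * A4) by nra.
  exists (gamma * A1 + A2 + A3 + 2 * (gamma * A4)). split; [nra|].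
  intros eps y y1 Y x Hx. destruct (sol_eps _ _ _ Y) as [He He1].
  specialize (HA1 _ _ _ Y x Hx). specialize (HA2 _ _ _ Y x Hx).
  specialize (HA3 _ _ _ Y x Hx). specialize (HA4 _ _ _ Y x Hx).
  assert (PL : 0 < layer d eps x / eps) by (apply Rdiv_lt_0_compat; auto using layer_pos).
  assert (Pe : 0 < eps ^ 2) by nra.
  assert (PQ : 0 < layer d eps x / eps ^ 2) by (apply Rdiv_lt_0_compat; auto using layer_pos).
  split.
  - unfold reduced1. eapply Rle_trans; [apply Rabs_triang|].
    rewrite Rabs_Ropp, Rabs_mult, (Rabs_pos_eq gamma) by lra.
    apply Rle_trans with (gamma * (A1 * (1 + layer d eps x / eps)) + A2 * (1 + layer d eps x / eps)).
    + apply Rplus_le_compat; auto. apply Rmult_le_compat_l; lra.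
    + nra.
  - unfold reduced2, rhs2.
    set (Q := layer d eps x / eps ^ 2) in *.
    set (T := / eps ^ 2 * f x (y x)).
    assert (HT : Rabs T <= A4 * (1 + Q)).
    { unfold T. rewrite Rabs_mult, Rabs_pos_eq by (left; now apply Rinv_0_lt_compat).
      apply Rle_trans with (/ eps ^ 2 * (A4 * (eps ^ 2 + layer d eps x))).
      - apply Rmult_le_compat_l; [left; now apply Rinv_0_lt_compat|exact HA4].
      - right; unfold Q; field; lra. }
    pose proof (sm_fv_bounds HS x (y x) Hx) as Hc.
    replace (gamma * T - (rhs2_low y y1 x + fv x (y x) * T))
      with ((gamma - fv x (y x)) * T - rhs2_low y y1 x) by ring.
    eapply Rle_trans; [apply Rabs_triang|].
    rewrite Rabs_Ropp, Rabs_mult, Rabs_pos_eq by lra.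
    assert ((gamma - fv x (y x)) * Rabs T <= gamma * (A4 * (1 + Q))).
    { apply Rmult_le_compat; auto using Rabs_pos; lra. }
    nra.
Qed.

End Solution.

(** * Truncation error *)

Lemma cosh_sinh_sqr x : cosh x * cosh x = 1 + sinh x * sinh x.
Proof.
  unfold cosh, sinh. assert (E : exp x * exp (- x) = 1).
  { rewrite <- exp_plus, Rplus_opp_r. apply exp_0. }
  nra.
Qed.

Lemma cosh_ge_1 x : 1 <= cosh x.
Proof.
  assert (0 < cosh x).
  { unfold cosh. pose proof (exp_pos x). pose proof (exp_pos (- x)). lra. }
  pose proof (cosh_sinh_sqr x). nra.
Qed.

Lemma sinh_pos x : 0 < x -> 0 < sinh x.
Proof. intros H. rewrite <- sinh_0. now apply sinh_lt. Qed.

Lemma sinh_opp x : sinh (- x) = - sinh x.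
Proof. unfold sinh. rewrite Ropp_involutive. field. Qed.

Lemma cosh_opp x : cosh (- x) = cosh x.
Proof. unfold cosh. rewrite Ropp_involutive. field. Qed.

Lemma derive_sinh x : is_derive sinh x (cosh x).
Proof. apply is_derive_Reals, derivable_pt_lim_sinh. Qed.

Lemma sinh_ge_id x : 0 <= x -> x <= sinh x.
Proof.
  intros Hx.
  destruct (MVT_gen sinh 0 x cosh) as [c [_ E]].
  - intros; apply derive_sinh.
  - intros s _. apply derivable_continuous_pt, derivable_pt_sinh.
  - rewrite sinh_0 in E. pose proof (cosh_ge_1 c). nra.
Qed.

(** This is tanh (x / 2), in the form in which it occurs in the scheme. *)
Definition half_tanh (x : R) : R := (cosh x - 1) / sinh x.

Lemma half_tanh_pos x : 0 < x -> 0 < half_tanh x.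
Proof.
  intros Hx. pose proof (sinh_pos x Hx). pose proof (cosh_ge_1 x).
  pose proof (cosh_sinh_sqr x). apply Rdiv_lt_0_compat; nra.
Qed.

Lemma mean_value_pos (u d : R -> R) (x z : R) :
  (forall s, 0 < s -> is_derive u s (d s)) -> 0 < x -> 0 < z ->
  exists c, Rmin x z <= c <= Rmax x z /\ u z - u x = d c * (z - x).
Proof.
  intros Hu Hx Hz. assert (P : 0 < Rmin x z) by (apply Rmin_glb_lt; lra).
  destruct (MVT_gen u x z d) as [c Hc].
  - intros s Hs; apply Hu; lra.
  - intros s Hs. apply derivable_continuous_pt. exists (d s).
    apply is_derive_Reals, Hu. lra.
  - now exists c.
Qed.

Lemma half_tanh_increasing x z : 0 < x -> x <= z -> half_tanh x <= half_tanh z.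
Proof.
  intros Hx Hxz.
  destruct (mean_value_pos half_tanh (fun s => (cosh s - 1) / sinh s ^ 2) x z) as [c [Hc E]];
    try lra.
  - intros s Hs. pose proof (sinh_pos s Hs) as P. unfold half_tanh.
    assert (D : is_derive (fun s => (cosh s - 1) / sinh s) s
      ((sinh s * sinh s - (cosh s - 1) * cosh s) / sinh s ^ 2)).
    { apply (is_derive_div (fun s => cosh s - 1) sinh s (sinh s) (cosh s)); try lra.
      - unfold cosh, sinh. auto_derive; [easy|field].
      - apply derive_sinh. }
    replace (sinh s * sinh s - (cosh s - 1) * cosh s) with (cosh s - 1) in D
      by (pose proof (cosh_sinh_sqr s); lra).
    exact D.
  - rewrite Rmin_left in Hc by lra.
    assert (0 <= (cosh c - 1) / sinh c ^ 2).
    { apply Rdiv_le_0_compat; [pose proof (cosh_ge_1 c); lra|].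
      apply pow_lt, sinh_pos; lra. }
    nra.
Qed.

(** The first moment of the weights of the scheme is this difference.  The
    derivative of x / sinh x is at most tanh (x / 2) in absolute value, so the
    weights are centred up to the difference of the two steps. *)
Lemma id_over_sinh_lipschitz x z : 0 < x -> 0 < z ->
  Rabs (z / sinh z - x / sinh x) <= (half_tanh x + half_tanh z) * Rabs (z - x).
Proof.
  intros Hx Hz.
  destruct (mean_value_pos (fun s => s / sinh s)
    (fun s => (sinh s - s * cosh s) / sinh s ^ 2) x z) as [c [Hc E]]; try lra.
  { intros s Hs. pose proof (sinh_pos s Hs) as P.
    replace (sinh s - s * cosh s) with (1 * sinh s - s * cosh s) by ring.
    apply (is_derive_div (fun s => s) sinh s 1 (cosh s)); try lra.
    - apply (is_derive_id s).
    - apply derive_sinh. }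
  rewrite E, Rabs_mult. apply Rmult_le_compat_r; [apply Rabs_pos|].
  assert (P : 0 < Rmin x z) by (apply Rmin_glb_lt; lra).
  assert (Pc : 0 < c) by lra.
  pose proof (sinh_pos c Pc) as Ps. pose proof (sinh_ge_id c) as Hs.
  pose proof (cosh_ge_1 c) as Hch.
  apply Rle_trans with (half_tanh c).
  - assert (Sgn : sinh c - c * cosh c <= 0).
    { assert (K : forall s, is_derive (fun s => sinh s - s * cosh s) s (- (s * sinh s))).
      { intros s. unfold sinh, cosh. auto_derive; [easy|]. field. }
      destruct (MVT_gen (fun s => sinh s - s * cosh s) 0 c (fun s => - (s * sinh s)))
        as [b [Hb Eb]].
      - intros s _; apply K.
      - intros s _. apply derivable_continuous_pt. exists (- (s * sinh s)).
        apply is_derive_Reals, K.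
      - rewrite sinh_0 in Eb. rewrite Rmin_left, Rmax_right in Hb by lra.
        destruct (proj1 Hb) as [Hb'|<-]; [|lra].
        pose proof (sinh_pos b Hb'). pose proof (Rmult_lt_0_compat _ _ (Rmult_lt_0_compat _ _ Hb' H) Pc). lra. }
    rewrite Rabs_left1.
    + unfold half_tanh.
      apply Rmult_le_reg_r with (sinh c ^ 2); [now apply pow_lt|].
      replace (- ((sinh c - c * cosh c) / sinh c ^ 2) * sinh c ^ 2)
        with (c * cosh c - sinh c) by (field; lra).
      replace ((cosh c - 1) / sinh c * sinh c ^ 2) with ((cosh c - 1) * sinh c) by (field; lra).
      assert (c <= sinh c) by (apply Hs; lra). nra.
    + apply Rmult_le_reg_r with (sinh c ^ 2); [now apply pow_lt|].
      replace ((sinh c - c * cosh c) / sinh c ^ 2 * sinh c ^ 2)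
        with (sinh c - c * cosh c) by (field; lra). lra.
  - pose proof (half_tanh_pos x Hx). pose proof (half_tanh_pos z Hz).
    assert (M : half_tanh c <= half_tanh (Rmax x z)) by (apply half_tanh_increasing; lra).
    unfold Rmax in M; destruct Rle_dec; lra.
Qed.

(** The bracket is, up to a constant, the variation of
    sinh(beta(z-c)) w' - beta cosh(beta(z-c)) w between c and x; its derivative
    is a multiple of sinh(beta(z-c)) r. *)
Lemma half_stencil (beta M c x : R) (w w1 r : R -> R) :
  0 < beta -> unit_interval c -> unit_interval x ->
  (forall s, unit_interval s -> D_in w w1 unit_interval s) ->
  (forall s, unit_interval s ->
     D_in w1 (fun s => beta ^ 2 * (w s - r s)) unit_interval s) ->
  (forall s, Rmin c x <= s <= Rmax c x -> Rabs (r s) <= M) ->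
  Rabs (sinh (beta * (x - c)) * w1 x - beta * cosh (beta * (x - c)) * w x + beta * w c)
  <= M * beta * (cosh (beta * (x - c)) - 1).
Proof.
  intros Hb Hc Hx Hw Hw1 Hr.
  apply Rabs_le_of_signs. intros sg Hsg.
  set (sh := fun z => sinh (beta * (z - c))).
  set (ch := fun z => cosh (beta * (z - c))).
  assert (Dsh : forall z, D_in sh (fun z => beta * ch z) unit_interval z).
  { intros z. apply D_in_of_is_derive. unfold sh, ch, sinh, cosh.
    auto_derive; [easy|]. unfold Rminus; field. }
  assert (Dch : forall z, D_in ch (fun z => beta * sh z) unit_interval z).
  { intros z. apply D_in_of_is_derive. unfold sh, ch, sinh, cosh.
    auto_derive; [easy|]. unfold Rminus; field. }
  set (u := fun z => M * beta * ch z + sg * (sh z * w1 z - beta * (ch z * w z))).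
  set (du := fun z => M * beta * (beta * sh z) + sg * (
     (beta * ch z * w1 z + sh z * (beta ^ 2 * (w z - r z)))
     - beta * (beta * sh z * w z + ch z * w1 z))).
  assert (Du : forall z, unit_interval z -> D_in u du unit_interval z).
  { intros z Uz. unfold u, du. apply Dadd.
    - apply (Dmult_const _ ch (fun z => beta * sh z)), Dch.
    - apply (Dmult_const _ (fun z => sh z * w1 z - beta * (ch z * w z))
        (fun z => (beta * ch z * w1 z + sh z * (beta ^ 2 * (w z - r z)))
                  - beta * (beta * sh z * w z + ch z * w1 z))).
      apply Dminus.
      + apply (Dmult _ (fun z => beta * ch z) (fun z => beta ^ 2 * (w z - r z))); auto.
      + apply (Dmult_const _ (fun z => ch z * w z)
          (fun z => beta * sh z * w z + ch z * w1 z)).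
        apply (Dmult _ (fun z => beta * sh z) w1); auto. }
  (* The factors sinh(beta(b-c)) and x - c have the same sign. *)
  destruct (mean_value u du c x Du Hc Hx) as [b [Hbt E]].
  assert (Edu : du b = beta ^ 2 * sh b * (M - sg * r b)) by (unfold du; ring).
  assert (Q : 0 <= M - sg * r b).
  { specialize (Hr b Hbt). apply Rabs_le_between in Hr. destruct Hsg; subst; lra. }
  assert (P : 0 <= sh b * (x - c)).
  { unfold sh. unfold Rmin, Rmax in Hbt; destruct Rle_dec.
    - destruct (proj1 Hbt) as [H|<-].
      + pose proof (sinh_pos (beta * (b - c))). nra.
      + rewrite Rminus_diag, Rmult_0_r, sinh_0; lra.
    - destruct (proj2 Hbt) as [H| ->].
      + pose proof (sinh_pos (beta * (c - b))) as Hs.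
        replace (beta * (b - c)) with (- (beta * (c - b))) by ring.
        rewrite sinh_opp. nra.
      + rewrite Rminus_diag, Rmult_0_r, sinh_0; lra. }
  assert (N : 0 <= u x - u c).
  { rewrite E, Edu.
    replace (beta ^ 2 * sh b * (M - sg * r b) * (x - c))
      with (beta ^ 2 * (M - sg * r b) * (sh b * (x - c))) by ring.
    apply Rmult_le_pos; [apply Rmult_le_pos|]; auto using pow2_ge_0. }
  unfold u in N.
  replace (ch c) with 1 in N
    by (unfold ch; now rewrite Rminus_diag, Rmult_0_r, cosh_0).
  replace (sh c) with 0 in N
    by (unfold sh; now rewrite Rminus_diag, Rmult_0_r, sinh_0).
  unfold sh, ch in N. lra.
Qed.

(** The three-point scheme applied to [w]; it annihilates the exponentials
    exp(beta z) and exp(- beta z). *)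
Definition stencil (H K wl w0 wr : R) : R :=
  / sinh H * (wl - w0) + / sinh K * (wr - w0) - (half_tanh H + half_tanh K) * w0.

Lemma stencil_bound (beta M x h k : R) (w w1 r : R -> R) :
  0 < beta -> 0 < h -> 0 < k -> 0 <= x - h -> x + k <= 1 ->
  (forall s, unit_interval s -> D_in w w1 unit_interval s) ->
  (forall s, unit_interval s ->
     D_in w1 (fun s => beta ^ 2 * (w s - r s)) unit_interval s) ->
  (forall s, x - h <= s <= x + k -> Rabs (r s) <= M) ->
  Rabs (stencil (beta * h) (beta * k) (w (x - h)) (w x) (w (x + k)))
  <= M * (half_tanh (beta * h) + half_tanh (beta * k)).
Proof.
  intros Hb Hh Hk H0 H1 Hw Hw1 Hr.
  assert (A := half_stencil beta M (x - h) x w w1 r Hb).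
  assert (B := half_stencil beta M (x + k) x w w1 r Hb).
  replace (beta * (x - (x - h))) with (beta * h) in A by ring.
  replace (beta * (x - (x + k))) with (- (beta * k)) in B by ring.
  rewrite sinh_opp, cosh_opp in B.
  rewrite Rmin_left, Rmax_right in A by lra. rewrite Rmin_right, Rmax_left in B by lra.
  specialize (A ltac:(unfold unit_interval; lra) ltac:(unfold unit_interval; lra) Hw Hw1
    ltac:(intros; apply Hr; lra)).
  specialize (B ltac:(unfold unit_interval; lra) ltac:(unfold unit_interval; lra) Hw Hw1
    ltac:(intros; apply Hr; lra)).
  pose proof (sinh_pos (beta * h) ltac:(nra)) as SH.
  pose proof (sinh_pos (beta * k) ltac:(nra)) as SK.
  set (H := beta * h) in *. set (K := beta * k) in *.
  replace (stencil H K (w (x - h)) (w x) (w (x + k))) with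
    ((sinh H * w1 x - beta * cosh H * w x + beta * w (x - h)) / (beta * sinh H)
     + (- sinh K * w1 x - beta * cosh K * w x + beta * w (x + k)) / (beta * sinh K))
    by (unfold stencil, half_tanh; field; lra).
  eapply Rle_trans; [apply Rabs_triang|]. rewrite Rmult_plus_distr_l.
  unfold Rdiv. rewrite !Rabs_mult, !Rabs_inv, (Rabs_pos_eq (beta * sinh H)),
    (Rabs_pos_eq (beta * sinh K)) by nra.
  apply Rplus_le_compat.
  - apply Rmult_le_reg_r with (beta * sinh H); [nra|].
    rewrite Rmult_assoc, Rinv_l, Rmult_1_r by nra.
    eapply Rle_trans; [exact A|]. right; unfold half_tanh; field; lra.
  - apply Rmult_le_reg_r with (beta * sinh K); [nra|].
    rewrite Rmult_assoc, Rinv_l, Rmult_1_r by nra.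
    eapply Rle_trans; [exact B|]. right; unfold half_tanh; field; lra.
Qed.

(** Subtracting from [y] the exact solution l / gamma that belongs to the affine
    function l(z) = g(x) + g1 (z - x) leaves a problem with a right-hand side of
    size M; on l / gamma itself the error is the first moment of the weights. *)
Lemma stencil_truncation (gamma beta M g1 x h k : R) (y y1 g : R -> R) :
  0 < gamma -> 0 < beta -> 0 < h -> 0 < k -> 0 <= x - h -> x + k <= 1 ->
  (forall s, unit_interval s -> D_in y y1 unit_interval s) ->
  (forall s, unit_interval s ->
     D_in y1 (fun s => beta ^ 2 * (y s - g s / gamma)) unit_interval s) ->
  (forall s, x - h <= s <= x + k -> Rabs (g s - g x - g1 * (s - x)) <= M) ->
  Rabs (gamma / (half_tanh (beta * h) + half_tanh (beta * k))
        * stencil (beta * h) (beta * k) (y (x - h)) (y x) (y (x + k)) + g x)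
  <= M + Rabs g1 * Rabs (k - h).
Proof.
  intros Hg Hb Hh Hk H0 H1 Hy Hy1 Hr.
  set (w := fun z => y z - / gamma * (g x + g1 * (z - x))).
  set (r := fun z => / gamma * (g z - g x - g1 * (z - x))).
  assert (A := stencil_bound beta (/ gamma * M) x h k w (fun z => y1 z - / gamma * g1) r
    Hb Hh Hk H0 H1).
  assert (PH : 0 < beta * h) by nra. assert (PK : 0 < beta * k) by nra.
  pose proof (sinh_pos _ PH) as SH. pose proof (sinh_pos _ PK) as SK.
  pose proof (half_tanh_pos _ PH) as TH. pose proof (half_tanh_pos _ PK) as TK.
  pose proof (id_over_sinh_lipschitz _ _ PH PK) as L.
  assert (Pg : 0 < / gamma) by now apply Rinv_0_lt_compat.
  set (H := beta * h) in *. set (K := beta * k) in *.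
  set (D := half_tanh H + half_tanh K) in *.
  assert (PD : 0 < D) by (unfold D; lra).
  assert (B : Rabs (stencil H K (w (x - h)) (w x) (w (x + k))) <= / gamma * M * D).
  { apply A.
    - intros s Us. apply Dminus; [now apply Hy|].
      apply D_in_of_is_derive. auto_derive; [easy|ring].
    - intros s Us. apply (D_in_ext (fun s => beta ^ 2 * (y s - g s / gamma) - 0)).
      { unfold w, r. field. lra. }
      apply (Dminus _ _ (fun _ => 0) y1); [now apply Hy1|apply Dconst].
    - intros s Hs. unfold r. rewrite Rabs_mult, (Rabs_pos_eq (/ gamma)) by lra.
      apply Rmult_le_compat_l; [lra|auto]. }
  replace (gamma / D * stencil H K (y (x - h)) (y x) (y (x + k)) + g x) with
    (gamma / D * stencil H K (w (x - h)) (w x) (w (x + k))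
     + g1 / (beta * D) * (K / sinh K - H / sinh H)).
  - eapply Rle_trans; [apply Rabs_triang|]. rewrite !Rabs_mult.
    apply Rplus_le_compat.
    + rewrite Rabs_pos_eq by (left; apply Rdiv_lt_0_compat; lra).
      apply Rle_trans with (gamma / D * (/ gamma * M * D)).
      * apply Rmult_le_compat_l; [left; apply Rdiv_lt_0_compat; lra|exact B].
      * right; field; lra.
    + apply Rle_trans with (Rabs (g1 / (beta * D)) * (D * Rabs (K - H))).
      * apply Rmult_le_compat_l; [apply Rabs_pos|exact L].
      * right. unfold Rdiv. rewrite Rabs_mult, Rabs_inv, (Rabs_pos_eq (beta * D)) by nra.
        replace (K - H) with (beta * (k - h)) by (unfold K, H; ring).
        rewrite Rabs_mult, (Rabs_pos_eq beta) by lra. field; lra.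
  - unfold stencil, w. fold D.
    replace (H / sinh H) with (beta * h / sinh H) by reflexivity.
    replace (K / sinh K) with (beta * k / sinh K) by reflexivity.
    field. repeat split; lra.
Qed.

(** * The mesh *)

Definition glue (c : R) (u v : R -> R) (t : R) : R :=
  if Rle_dec t c then u t else v t.

Lemma glue_derive (c : R) (u v du dv : R -> R) :
  u c = v c -> du c = dv c ->
  (forall t, t <= c -> is_derive u t (du t)) ->
  (forall t, c <= t -> is_derive v t (dv t)) ->
  forall t, is_derive (glue c u v) t (glue c du dv t).
Proof.
  intros E0 E1 Hu Hv t. unfold glue at 2.
  destruct (Rle_dec t c) as [H|H]; [destruct H as [H|H]|].
  - apply (is_derive_ext_loc u); [|apply Hu; lra].
    exists (mkposreal (c - t) ltac:(lra)). intros s Hs.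
    change (Rabs (s - t) < c - t) in Hs.
    apply Rabs_def2 in Hs. unfold glue. destruct Rle_dec; [easy|]. lra.
  - subst t. assert (Du := Hu c (Rle_refl c)). assert (Dv := Hv c (Rle_refl c)).
    rewrite <- E1 in Dv. apply is_derive_Reals in Du. apply is_derive_Reals in Dv.
    apply is_derive_Reals. intros e He.
    destruct (Du e He) as [d1 H1]. destruct (Dv e He) as [d2 H2].
    exists (mkposreal (Rmin d1 d2) (Rmin_stable_in_posreal d1 d2)).
    intros h Hh Hlt; simpl in Hlt.
    pose proof (Rmin_l d1 d2). pose proof (Rmin_r d1 d2).
    unfold glue. destruct (Rle_dec c c) as [_|N]; [|lra].
    destruct (Rle_dec (c + h) c).
    + apply H1; auto; lra.
    + rewrite E0. apply H2; auto; lra.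
  - apply (is_derive_ext_loc v); [|apply Hv; lra].
    exists (mkposreal (t - c) ltac:(lra)). intros s Hs.
    change (Rabs (s - t) < t - c) in Hs.
    apply Rabs_def2 in Hs. unfold glue. destruct Rle_dec; [|easy]. lra.
Qed.

Lemma exp_neg_le_pow (n : nat) (v : R) :
  (0 < n)%nat -> 0 < v -> exp (- v) <= (INR n / v) ^ n.
Proof.
  intros Hn Hv. assert (Pn : 0 < INR n) by now apply lt_0_INR.
  replace (- v) with (INR n * (- (v / INR n))) by (field; lra).
  assert (E : forall k, exp (INR k * (- (v / INR n))) = exp (- (v / INR n)) ^ k).
  { induction k as [|k IH].
    - simpl. rewrite Rmult_0_l. apply exp_0.
    - rewrite S_INR, Rmult_plus_distr_r, Rmult_1_l, exp_plus, IH. simpl. ring. }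
  rewrite E. apply pow_incr; split; [left; apply exp_pos|].
  assert (P : 0 < v / INR n) by (apply Rdiv_lt_0_compat; lra).
  rewrite exp_Ropp. replace (INR n / v) with (/ (v / INR n)) by (field; lra).
  apply Rinv_le_contravar; [exact P|]. pose proof (exp_ineq1_le (v / INR n)). lra.
Qed.

Section Mesh.

Variables (a p e eps : R).

Hypothesis Ha : 0 < a.
Hypothesis He : 0 < e.
Hypothesis Hep : e < p.
Hypothesis Hp : p < 1 / 2.
Hypothesis Heps : eps = e ^ 3.
Hypothesis Hroot : Rpower eps (1 / 3) = e.

Lemma alpha_root : alpha p eps = p - e.
Proof. unfold alpha. now rewrite Hroot. Qed.

Lemma eps_pos : 0 < eps.
Proof. rewrite Heps. now apply pow_lt. Qed.

Lemma root_sqr : Rpower eps (2 / 3) = e ^ 2.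
Proof.
  replace (2 / 3) with (1 / 3 + 1 / 3) by field. rewrite Rpower_plus, Hroot. ring.
Qed.

Definition kappa1 (t : R) : R := a * p * eps / (p - t) ^ 2.
Definition kappa2 (t : R) : R := 2 * a * p * eps / (p - t) ^ 3.

Lemma kappa_derive t : t < p -> is_derive (kappa a p eps) t (kappa1 t).
Proof. intros Ht. unfold kappa, kappa1. auto_derive; [lra|field; lra]. Qed.

Lemma kappa1_derive t : t < p -> is_derive kappa1 t (kappa2 t).
Proof.
  intros Ht. unfold kappa1, kappa2. auto_derive; [|field; lra].
  apply Rgt_not_eq, Rmult_gt_0_compat; lra.
Qed.

Definition cubic (t : R) : R :=
  omega a p eps * (t - alpha p eps) ^ 3 + a * p * (t - alpha p eps) ^ 2
  + a * p * e * (t - alpha p eps) + a * (p - e) * e ^ 2.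
Definition cubic1 (t : R) : R :=
  3 * omega a p eps * (t - alpha p eps) ^ 2 + 2 * a * p * (t - alpha p eps) + a * p * e.
Definition cubic2 (t : R) : R := 6 * omega a p eps * (t - alpha p eps) + 2 * a * p.

Lemma pi_mesh_cubic t : pi_mesh a p eps t = cubic t.
Proof.
  unfold pi_mesh, cubic.
  assert (Hal : alpha p eps < p) by (rewrite alpha_root; lra).
  rewrite (is_derive_unique _ _ _ (kappa_derive _ Hal)).
  assert (D2 : Derive_n (kappa a p eps) 2 (alpha p eps) = kappa2 (alpha p eps)).
  { simpl. rewrite (Derive_ext_loc _ kappa1).
    - apply is_derive_unique, kappa1_derive, Hal.
    - exists (mkposreal (p - alpha p eps) ltac:(lra)). intros s Hs.
      change (Rabs (s - alpha p eps) < p - alpha p eps) in Hs.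
      apply Rabs_def2 in Hs. apply is_derive_unique, kappa_derive. lra. }
  rewrite D2. unfold kappa, kappa1, kappa2. rewrite !alpha_root, Heps.
  replace (p - (p - e)) with e by ring. field. lra.
Qed.

Definition left1 : R -> R := glue (alpha p eps) kappa1 cubic1.
Definition left2 : R -> R := glue (alpha p eps) kappa2 cubic2.

Lemma phi_left_derive t : is_derive (phi_left a p eps) t (left1 t).
Proof.
  apply (is_derive_ext (glue (alpha p eps) (kappa a p eps) cubic)).
  { intros s. unfold glue, phi_left. destruct Rle_dec; [easy|].
    symmetry. apply pi_mesh_cubic. }
  unfold left1. apply glue_derive.
  - unfold kappa, cubic. rewrite alpha_root, Heps. field. lra.
  - unfold kappa1, cubic1. rewrite alpha_root, Heps. field. lra.
  - intros s Hs. apply kappa_derive. rewrite alpha_root in Hs. lra.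
  - intros s _. unfold cubic, cubic1. auto_derive; [easy|ring].
Qed.

Lemma left1_derive t : is_derive left1 t (left2 t).
Proof.
  unfold left1, left2. apply glue_derive.
  - unfold kappa1, cubic1. rewrite alpha_root, Heps. field. lra.
  - unfold kappa2, cubic2. rewrite alpha_root, Heps. field. lra.
  - intros s Hs. apply kappa1_derive. rewrite alpha_root in Hs. lra.
  - intros s _. unfold cubic1, cubic2. auto_derive; [easy|ring].
Qed.

Lemma phi_left_0 : phi_left a p eps 0 = 0.
Proof.
  unfold phi_left. rewrite alpha_root. destruct Rle_dec; [|lra].
  unfold kappa. field. lra.
Qed.

Lemma phi_left_half : phi_left a p eps (1 / 2) = 1 / 2.
Proof.
  unfold phi_left. rewrite alpha_root. destruct Rle_dec; [lra|].
  rewrite pi_mesh_cubic. unfold cubic, omega. rewrite Hroot, root_sqr, alpha_root.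
  field. lra.
Qed.

Lemma phi_left_alpha : phi_left a p eps (alpha p eps) = a * (p - e) * e ^ 2.
Proof.
  unfold phi_left. destruct Rle_dec; [|lra].
  unfold kappa. rewrite alpha_root, Heps. field. lra.
Qed.

Hypothesis Hom : 0 <= omega a p eps.

Definition omega_max : R := 1 / 2 * / (1 / 2 - p) ^ 3.

Lemma omega_le : omega a p eps <= omega_max.
Proof.
  unfold omega, omega_max. rewrite Hroot, root_sqr, alpha_root.
  assert (P1 : 0 < (1 / 2 - p) ^ 3) by (apply pow_lt; lra).
  assert (P2 : (1 / 2 - p) ^ 3 <= (1 / 2 - (p - e)) ^ 3) by (apply pow_incr; lra).
  assert (I : / (1 / 2 - (p - e)) ^ 3 <= / (1 / 2 - p) ^ 3) by now apply Rinv_le_contravar.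
  assert (0 < / (1 / 2 - (p - e)) ^ 3) by (apply Rinv_0_lt_compat; lra).
  assert (0 <= a * (p * (1 / 2 - (p - e)) ^ 2 + p * (1 / 2 - (p - e)) * e + (p - e) * e ^ 2)).
  { apply Rmult_le_pos; [lra|].
    assert (0 <= p * (1 / 2 - (p - e)) ^ 2) by (apply Rmult_le_pos; [lra|apply pow2_ge_0]).
    assert (0 <= p * (1 / 2 - (p - e)) * e) by (repeat apply Rmult_le_pos; lra).
    assert (0 <= (p - e) * e ^ 2) by (apply Rmult_le_pos; [lra|apply pow2_ge_0]).
    lra. }
  nra.
Qed.

(** Bounds the second derivative of the left half of the generating function. *)
Definition curvature : R := 3 * omega_max + 2 * (a * p).

Lemma omega_max_pos : 0 < omega_max.
Proof.
  unfold omega_max. apply Rmult_lt_0_compat; [lra|]. apply Rinv_0_lt_compat, pow_lt. lra.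
Qed.

Lemma curvature_pos : 0 < curvature.
Proof.
  pose proof omega_max_pos. unfold curvature. assert (0 < a * p) by nra. lra.
Qed.

Lemma left1_pos t : t <= 1 / 2 -> 0 < left1 t.
Proof.
  intros Ht. pose proof eps_pos. unfold left1, glue.
  assert (0 < a * p) by nra.
  destruct Rle_dec as [H'|H'].
  - rewrite alpha_root in H'. apply Rdiv_lt_0_compat; [nra|apply pow_lt; lra].
  - unfold cubic1. set (x := t - alpha p eps). assert (0 < x) by (unfold x; lra).
    assert (0 <= 3 * omega a p eps * x ^ 2)
      by (apply Rmult_le_pos; [lra|apply pow2_ge_0]).
    assert (0 < 2 * a * p * x) by nra. assert (0 < a * p * e) by nra. lra.
Qed.

Lemma left1_le t : t <= 1 / 2 -> left1 t <= curvature * (e + Rmax 0 (t - alpha p eps)).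
Proof.
  intros Ht. pose proof curvature_pos as PC. pose proof omega_max_pos.
  pose proof omega_le. assert (PA : 0 < a * p) by nra.
  unfold left1, glue. destruct Rle_dec as [H'|H'].
  - pose proof (Rmax_l 0 (t - alpha p eps)). rewrite alpha_root in H'.
    apply Rle_trans with (a * p * e).
    + unfold kappa1. apply Rmult_le_reg_r with ((p - t) ^ 2); [apply pow_lt; lra|].
      replace (a * p * eps / (p - t) ^ 2 * (p - t) ^ 2) with (a * p * e * e ^ 2)
        by (rewrite Heps; field; lra).
      apply Rmult_le_compat_l; [nra|]. apply pow_incr; lra.
    + apply Rle_trans with (curvature * e); [|nra].
      apply Rmult_le_compat_r; [lra|]. unfold curvature; lra.
  - rewrite Rmax_right by lra. unfold cubic1.
    set (x := t - alpha p eps). assert (0 < x <= 1 / 2 - p + e)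
      by (unfold x; rewrite alpha_root in *; lra).
    assert (omega a p eps * x ^ 2 <= omega_max * x).
    { apply Rle_trans with (omega a p eps * x).
      - apply Rmult_le_compat_l; [lra|]. assert (x <= 1) by lra. nra.
      - apply Rmult_le_compat_r; lra. }
    unfold curvature. nra.
Qed.

Lemma left1_le_const t : t <= 1 / 2 -> left1 t <= 2 * curvature.
Proof.
  intros Ht. eapply Rle_trans; [now apply left1_le|]. pose proof curvature_pos.
  rewrite (Rmult_comm 2). apply Rmult_le_compat_l; [lra|].
  rewrite alpha_root. unfold Rmax; destruct Rle_dec; lra.
Qed.

Lemma left2_bounds t : t <= 1 / 2 -> 0 <= left2 t <= curvature.
Proof.
  intros Ht. pose proof eps_pos. pose proof omega_max_pos.
  pose proof omega_le. assert (PA : 0 < a * p) by nra.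
  unfold left2, glue. destruct Rle_dec as [H'|H'].
  - rewrite alpha_root in H'. unfold kappa2.
    assert (P : 0 < (p - t) ^ 3) by (apply pow_lt; lra).
    split; [apply Rdiv_le_0_compat; nra|].
    apply Rle_trans with (2 * (a * p)); [|unfold curvature; lra].
    apply Rmult_le_reg_r with ((p - t) ^ 3); [exact P|].
    replace (2 * a * p * eps / (p - t) ^ 3 * (p - t) ^ 3) with (2 * (a * p) * e ^ 3)
      by (rewrite Heps; field; lra).
    apply Rmult_le_compat_l; [lra|]. apply pow_incr; lra.
  - unfold cubic2. set (x := t - alpha p eps). assert (0 < x <= 1 / 2)
      by (unfold x; rewrite alpha_root in *; lra).
    assert (0 <= omega a p eps * x <= omega_max * (1 / 2)).
    { split; [apply Rmult_le_pos; lra|]. apply Rmult_le_compat; lra. }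
    unfold curvature. lra.
Qed.

(** Up to the pole p the growth of the derivatives is that of kappa also beyond
    the transition point alpha, because p - alpha = eps^(1/3). *)
Lemma left_layer_bounds t : t < p ->
  left1 t <= 2 * curvature * (eps / (p - t) ^ 2) /\
  left2 t <= curvature * (eps / (p - t) ^ 3).
Proof.
  intros Ht. pose proof eps_pos as Pe. pose proof curvature_pos as PC.
  pose proof omega_max_pos. assert (PA : 0 < a * p) by nra.
  assert (P2 : 0 < (p - t) ^ 2) by (apply pow_lt; lra).
  assert (P3 : 0 < (p - t) ^ 3) by (apply pow_lt; lra).
  destruct (Rle_dec t (alpha p eps)) as [H'|H'].
  - unfold left1, left2, glue. destruct Rle_dec as [_|]; [|lra].
    unfold kappa1, kappa2.
    assert (Q2 : 0 < eps / (p - t) ^ 2) by now apply Rdiv_lt_0_compat.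
    assert (Q3 : 0 < eps / (p - t) ^ 3) by now apply Rdiv_lt_0_compat.
    replace (a * p * eps / (p - t) ^ 2) with (a * p * (eps / (p - t) ^ 2)) by (field; lra).
    replace (2 * a * p * eps / (p - t) ^ 3) with (2 * (a * p) * (eps / (p - t) ^ 3))
      by (field; lra).
    split; apply Rmult_le_compat_r; unfold curvature; lra.
  - assert (Hal : p - t < e) by (rewrite alpha_root in H'; lra).
    assert (L2 : e <= eps / (p - t) ^ 2).
    { apply Rmult_le_reg_r with ((p - t) ^ 2); [exact P2|].
      replace (eps / (p - t) ^ 2 * (p - t) ^ 2) with (e * e ^ 2) by (rewrite Heps; field; lra).
      apply Rmult_le_compat_l; [lra|]. apply pow_incr; lra. }
    assert (L3 : 1 <= eps / (p - t) ^ 3).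
    { apply Rmult_le_reg_r with ((p - t) ^ 3); [exact P3|].
      replace (eps / (p - t) ^ 3 * (p - t) ^ 3) with (e ^ 3) by (rewrite Heps; field; lra).
      rewrite Rmult_1_l. apply pow_incr; lra. }
    split.
    + eapply Rle_trans; [apply left1_le; lra|]. rewrite Rmax_right by lra.
      apply Rle_trans with (curvature * (2 * e)).
      * apply Rmult_le_compat_l; [lra|]. rewrite alpha_root; lra.
      * replace (curvature * (2 * e)) with (2 * curvature * e) by ring.
        apply Rmult_le_compat_l; lra.
    + eapply Rle_trans; [apply left2_bounds; lra|].
      rewrite <- (Rmult_1_r curvature) at 1. apply Rmult_le_compat_l; lra.
Qed.

Lemma phi_left_D_in t : D_in (phi_left a p eps) left1 unit_interval t.
Proof. apply D_in_of_is_derive, phi_left_derive. Qed.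

Lemma left1_D_in t : D_in left1 left2 unit_interval t.
Proof. apply D_in_of_is_derive, left1_derive. Qed.

Lemma phi_left_increment (B s t : R) :
  0 <= s -> s <= t -> t <= 1 / 2 ->
  (forall x, s <= x <= t -> left1 x <= B) ->
  phi_left a p eps t - phi_left a p eps s <= B * (t - s).
Proof.
  intros Hs Hst Ht HB.
  destruct (mean_value (phi_left a p eps) left1 s t) as [c [Hc E]];
    try (unfold unit_interval; lra).
  { intros; apply phi_left_D_in. }
  rewrite Rmin_left, Rmax_right in Hc by lra. rewrite E.
  apply Rmult_le_compat_r; [lra|now apply HB].
Qed.

Lemma phi_left_increasing (s t : R) :
  0 <= s -> s < t -> t <= 1 / 2 -> phi_left a p eps s < phi_left a p eps t.
Proof.
  intros Hs Hst Ht.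
  destruct (mean_value (phi_left a p eps) left1 s t) as [c [Hc E]];
    try (unfold unit_interval; lra).
  { intros; apply phi_left_D_in. }
  rewrite Rmin_left, Rmax_right in Hc by lra.
  pose proof (left1_pos c). nra.
Qed.

Lemma phi_left_second_difference (B t tau : R) :
  0 <= t - tau -> t + tau <= 1 / 2 -> 0 <= tau ->
  (forall x, t - tau <= x <= t + tau -> left2 x <= B) ->
  Rabs (phi_left a p eps (t + tau) - 2 * phi_left a p eps t + phi_left a p eps (t - tau))
  <= 2 * B * tau ^ 2.
Proof.
  intros H0 H1 Htau HB.
  assert (T : forall z, t - tau <= z <= t + tau ->
    Rabs (phi_left a p eps z - phi_left a p eps t - left1 t * (z - t)) <= B * (z - t) ^ 2).
  { intros z Hz. apply (taylor2 _ left1 left2 (t - tau) (t + tau)); try lra.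
    - intros; apply phi_left_D_in.
    - intros; apply left1_D_in.
    - intros x Hx. rewrite Rabs_pos_eq; [now apply HB|]. apply left2_bounds; lra. }
  assert (T1 := T (t + tau) ltac:(lra)). assert (T2 := T (t - tau) ltac:(lra)).
  apply Rabs_le_between in T1. apply Rabs_le_between in T2.
  replace (t + tau - t) with tau in T1 by ring.
  replace (t - tau - t) with (- tau) in T2 by ring.
  apply Rabs_le. nra.
Qed.

End Mesh.

(** * Resolution of the layers by the mesh *)

(** The two ways in which a cell pair [xm, xp] can make the truncation error
    O(tau^2): either the steps and their difference are small relative to the
    derivatives of the layer function, or both the cell pair and the layer
    function on it are small. *)
Definition resolved (d eps C tau xm x0 xp : R) : Prop :=
  (forall x, xm <= x <= xp ->
     (xp - xm) ^ 2 * (1 + layer d eps x / eps ^ 2) <= C * tau ^ 2 /\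
     Rabs (xp - 2 * x0 + xm) * (1 + layer d eps x / eps) <= C * tau ^ 2) \/
  (forall x, xm <= x <= xp -> xp - xm + layer d eps x <= C * tau ^ 2).

Lemma resolved_weaken d eps C C' tau xm x0 xp :
  C <= C' -> resolved d eps C tau xm x0 xp -> resolved d eps C' tau xm x0 xp.
Proof.
  intros HC. assert (HT : C * tau ^ 2 <= C' * tau ^ 2)
    by (apply Rmult_le_compat_r; [apply pow2_ge_0|exact HC]).
  intros [H|H]; [left|right]; intros x Hx; specialize (H x Hx); lra.
Qed.

Lemma resolved_reflect d eps C tau xm x0 xp :
  resolved d eps C tau xm x0 xp -> resolved d eps C tau (1 - xp) (1 - x0) (1 - xm).
Proof.
  intros [H|H]; [left|right]; intros x Hx; specialize (H (1 - x) ltac:(lra));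
    rewrite layer_sym in H.
  - replace (1 - xm - (1 - xp)) with (xp - xm) by ring.
    replace (1 - xm - 2 * (1 - x0) + (1 - xp)) with (- (xp - 2 * x0 + xm)) by ring.
    now rewrite Rabs_Ropp.
  - lra.
Qed.

Lemma exp_neg_decreasing d eps x z :
  0 < d -> 0 < eps -> x <= z -> exp (- (d * z / eps)) <= exp (- (d * x / eps)).
Proof.
  intros Hd He Hxz. assert (d * x / eps <= d * z / eps).
  { apply Rmult_le_compat_r; [left; now apply Rinv_0_lt_compat|].
    apply Rmult_le_compat_l; lra. }
  destruct (Req_dec (d * x / eps) (d * z / eps)) as [E|E].
  - rewrite E; lra.
  - left; apply exp_increasing; lra.
Qed.

Lemma layer_left_half d eps x0 x :
  0 < d -> 0 < eps -> x0 <= x -> x <= 1 / 2 ->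
  layer d eps x <= exp (- (d * x0 / eps)) + 16 / d ^ 2 * eps ^ 2.
Proof.
  intros Hd He H0 H1. unfold layer. apply Rplus_le_compat.
  - now apply exp_neg_decreasing.
  - eapply Rle_trans; [apply (exp_neg_decreasing d eps (1 / 2)); lra|].
    eapply Rle_trans; [apply (exp_neg_le_pow 2); [lia|]|].
    + apply Rdiv_lt_0_compat; nra.
    + right. simpl INR. field. lra.
Qed.

Section Resolution.

Variables (a p d es e eps : R).

Hypothesis Ha : 0 < a.
Hypothesis Hd : 0 < d.
Hypothesis He : 0 < e.
Hypothesis Hes : e <= es.
Hypothesis Hesp : es < p.
Hypothesis Hp : p < 1 / 2.
Hypothesis Heps : eps = e ^ 3.
Hypothesis Hroot : Rpower eps (1 / 3) = e.
Hypothesis Hom : 0 <= omega a p eps.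

Let phil := phi_left a p eps.
Let K := curvature a p.

Definition far_constant : R := (6 / (d * a * (p - es))) ^ 6.

(** At the transition point the exponent is proportional to eps^(-1/3), so from
    there on the exponential is O(eps^n) for every n. *)
Lemma exp_far t : alpha p eps <= t -> t <= 1 / 2 ->
  exp (- (d * phil t / eps)) <= far_constant * eps ^ 2.
Proof.
  intros H0 H1. assert (Pe : 0 < eps) by (rewrite Heps; now apply pow_lt).
  assert (Hal : alpha p eps = p - e) by now apply alpha_root.
  assert (Hphi : a * (p - e) * e ^ 2 <= phil t).
  { rewrite <- (phi_left_alpha a p e eps); auto; try lra.
    destruct H0 as [H0|H0].
    - left. apply (phi_left_increasing a p e eps); auto; lra.
    - rewrite H0; right; reflexivity. }
  eapply Rle_trans; [apply (exp_neg_decreasing d eps (a * (p - es) * e ^ 2)); auto|].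
  - eapply Rle_trans; [|exact Hphi]. apply Rmult_le_compat_r; [apply pow2_ge_0|].
    apply Rmult_le_compat_l; lra.
  - assert (P : 0 < d * a * (p - es)) by (repeat apply Rmult_lt_0_compat; lra).
    replace (d * (a * (p - es) * e ^ 2) / eps) with (d * a * (p - es) / e)
      by (rewrite Heps; field; lra).
    (* eps^2 = e^6 dictates the exponent. *)
    eapply Rle_trans; [apply (exp_neg_le_pow 6); [lia|]|].
    + now apply Rdiv_lt_0_compat.
    + right. unfold far_constant. rewrite Heps.
      replace (INR 6) with 6 by (simpl; ring). field. repeat split; lra.
Qed.

(** In the distance s = p - t to the pole, t/(p-t) = p/s - 1, so the layer function
    at the mesh point is a multiple of exp(-d a p/s) whatever the value of eps. *)
Lemma exp_near (n : nat) t : (0 < n)%nat -> t <= alpha p eps -> t < p ->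
  exp (- (d * phil t / eps)) <= exp (d * a) * (INR n / (d * a * p) * (p - t)) ^ n.
Proof.
  intros Hn H0 H1. assert (Pe : 0 < eps) by (rewrite Heps; now apply pow_lt).
  unfold phil, phi_left. destruct Rle_dec; [|lra]. unfold kappa.
  assert (P : 0 < d * a * p) by (repeat apply Rmult_lt_0_compat; lra).
  replace (- (d * (a * eps * t / (p - t)) / eps))
    with (d * a + - (d * a * p / (p - t))) by (field; lra).
  rewrite exp_plus. apply Rmult_le_compat_l; [left; apply exp_pos|].
  eapply Rle_trans; [apply (exp_neg_le_pow n); [exact Hn|]|].
  - apply Rdiv_lt_0_compat; lra.
  - right. f_equal. field. repeat split; lra.
Qed.

Definition C_far : R := (16 * K ^ 2 + 2 * K) * (1 + (far_constant + 16 / d ^ 2)).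

Definition C_near : R :=
  (36 * K) ^ 2 * (exp (d * a) * (4 / (d * a * p)) ^ 4) + 16 * K ^ 2 * (1 + 16 / d ^ 2)
  + (54 * K * (exp (d * a) * (3 / (d * a * p)) ^ 3) + 2 * K * (1 + 16 / d ^ 2)).

Definition C_gap : R :=
  10 * K + (9 * (exp (d * a) * (2 / (d * a * p)) ^ 2) + 9 * (16 / d ^ 2)).

Lemma K_pos : 0 < K.
Proof. apply (curvature_pos a p e); lra. Qed.

Lemma eps_bounds : 0 < eps < 1.
Proof.
  rewrite Heps. split; [now apply pow_lt|].
  assert (e < 1) by lra. assert (e * e < 1) by nra. simpl. nra.
Qed.

Section Cells.

Variables (tau t : R).
Hypothesis Htau : 0 < tau.
Hypothesis Ht0 : 0 <= t - tau.
Hypothesis Ht1 : t + tau <= 1 / 2.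

Lemma phil_cell x : phil (t - tau) <= x <= phil (t + tau) -> 0 <= x <= 1 / 2.
Proof.
  intros [H0 H1].
  assert (Q0 : 0 <= phil (t - tau)).
  { rewrite <- (phi_left_0 a p e eps); auto; try lra.
    destruct Ht0 as [H|H].
    - left. apply (phi_left_increasing a p e eps); auto; lra.
    - rewrite <- H. right; reflexivity. }
  assert (Q1 : phil (t + tau) <= 1 / 2).
  { rewrite <- (phi_left_half a p e eps); auto; try lra.
    destruct Ht1 as [H|H].
    - left. apply (phi_left_increasing a p e eps); auto; lra.
    - rewrite H. right; reflexivity. }
  lra.
Qed.

Lemma cell_length_crude : 0 <= phil (t + tau) - phil (t - tau) <= 4 * K * tau.
Proof.
  split.
  - assert (phil (t - tau) < phil (t + tau)); [|lra].
    apply (phi_left_increasing a p e eps); auto; lra.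
  - replace (4 * K * tau) with (2 * K * (t + tau - (t - tau))) by ring.
    apply (phi_left_increment a p e eps); auto; try lra.
    intros x Hx. apply (left1_le_const a p e); auto; lra.
Qed.

Lemma cell_difference_crude :
  Rabs (phil (t + tau) - 2 * phil t + phil (t - tau)) <= 2 * K * tau ^ 2.
Proof.
  apply (phi_left_second_difference a p e eps); auto; try lra.
  intros x Hx. apply (left2_bounds a p e); auto; lra.
Qed.

Lemma resolved_far : alpha p eps <= t - tau ->
  resolved d eps C_far tau (phil (t - tau)) (phil t) (phil (t + tau)).
Proof.
  intros H. left. intros x Hx.
  destruct eps_bounds as [Pe Pe1].
  pose proof cell_length_crude as L. pose proof cell_difference_crude as D.
  pose proof K_pos. pose proof (phil_cell x Hx).
  set (Q := far_constant + 16 / d ^ 2).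
  assert (HE : layer d eps x <= Q * eps ^ 2).
  { eapply Rle_trans; [apply (layer_left_half d eps (phil (t - tau))); auto; lra|].
    pose proof (exp_far (t - tau) H ltac:(lra)). unfold Q. lra. }
  pose proof (layer_pos d eps x) as PL. assert (Pe2 : 0 < eps ^ 2) by now apply pow_lt.
  assert (HL2 : 0 < layer d eps x / eps ^ 2 <= Q).
  { split; [now apply Rdiv_lt_0_compat|].
    apply Rmult_le_reg_r with (eps ^ 2); [exact Pe2|].
    unfold Rdiv. rewrite Rmult_assoc, Rinv_l, Rmult_1_r; lra. }
  assert (HL1 : 0 < layer d eps x / eps <= Q).
  { split; [now apply Rdiv_lt_0_compat|].
    apply Rle_trans with (layer d eps x / eps ^ 2 * eps); [right; field; lra|nra]. }
  unfold C_far. fold Q.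
  assert (S2 : (phil (t + tau) - phil (t - tau)) ^ 2 <= 16 * K ^ 2 * tau ^ 2).
  { replace (16 * K ^ 2 * tau ^ 2) with ((4 * K * tau) ^ 2) by ring.
    apply pow_incr; exact L. }
  assert (T2 : 0 < tau ^ 2) by now apply pow_lt.
  assert (K2 : 0 < K ^ 2) by now apply pow_lt.
  assert (0 < K ^ 2 * tau ^ 2) by nra. assert (0 < K * tau ^ 2) by nra.
  split.
  - apply Rle_trans with (16 * K ^ 2 * tau ^ 2 * (1 + Q)).
    + apply Rmult_le_compat; [apply pow2_ge_0|lra|exact S2|lra].
    + nra.
  - apply Rle_trans with (2 * K * tau ^ 2 * (1 + Q)).
    + apply Rmult_le_compat; [apply Rabs_pos|lra|exact D|lra].
    + nra.
Qed.

(** The distance of the cell pair to the pole p is comparable to that of its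
    left end, so the negative powers of this distance that come from the mesh are
    absorbed by the exponential. *)
Lemma resolved_near : t - tau < alpha p eps -> 3 * tau <= p - (t - tau) ->
  resolved d eps C_near tau (phil (t - tau)) (phil t) (phil (t + tau)).
Proof.
  intros H Hs. left. intros x Hx.
  destruct eps_bounds as [Pe Pe1].
  pose proof cell_length_crude as Lc. pose proof cell_difference_crude as Dc.
  pose proof K_pos as PK. pose proof (phil_cell x Hx) as Ux.
  assert (Hal : alpha p eps = p - e) by now apply alpha_root.
  set (s := p - (t - tau)) in *.
  assert (Ps : 0 < s) by lra.
  assert (Near : forall r, t - tau <= r <= t + tau ->
    left1 a p e eps r <= 18 * K * (eps / s ^ 2) /\
    left2 a p eps r <= 27 * K * (eps / s ^ 3)).
  { intros r Hr. assert (Hr' : s / 3 <= p - r) by (unfold s in *; lra).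
    destruct (left_layer_bounds a p e eps Ha He ltac:(lra) Hp Heps Hroot Hom r ltac:(lra))
      as [B1 B2]. fold K in B1, B2.
    assert (I2 : eps / (p - r) ^ 2 <= 9 * (eps / s ^ 2)).
    { replace (9 * (eps / s ^ 2)) with (eps * / (s / 3) ^ 2) by (field; lra).
      apply Rmult_le_compat_l; [lra|]. apply Rinv_le_contravar; [apply pow_lt; lra|].
      apply pow_incr; lra. }
    assert (I3 : eps / (p - r) ^ 3 <= 27 * (eps / s ^ 3)).
    { replace (27 * (eps / s ^ 3)) with (eps * / (s / 3) ^ 3) by (field; lra).
      apply Rmult_le_compat_l; [lra|]. apply Rinv_le_contravar; [apply pow_lt; lra|].
      apply pow_incr; lra. }
    split; nra. }
  assert (L : phil (t + tau) - phil (t - tau) <= 36 * K * (eps / s ^ 2) * tau).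
  { replace (36 * K * (eps / s ^ 2) * tau)
      with (18 * K * (eps / s ^ 2) * (t + tau - (t - tau))) by ring.
    apply (phi_left_increment a p e eps); auto; try lra.
    intros r Hr. now apply Near. }
  assert (D : Rabs (phil (t + tau) - 2 * phil t + phil (t - tau))
    <= 2 * (27 * K * (eps / s ^ 3)) * tau ^ 2).
  { apply (phi_left_second_difference a p e eps); auto; try lra.
    intros r Hr. now apply Near. }
  assert (HE : layer d eps x <= exp (- (d * phil (t - tau) / eps)) + 16 / d ^ 2 * eps ^ 2)
    by (apply layer_left_half; auto; lra).
  assert (HE3 := exp_near 3 (t - tau) ltac:(lia) ltac:(lra) ltac:(lra)).
  assert (HE4 := exp_near 4 (t - tau) ltac:(lia) ltac:(lra) ltac:(lra)).
  fold s in HE3, HE4.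
  replace (INR 3) with 3 in HE3 by (simpl; ring).
  replace (INR 4) with 4 in HE4 by (simpl; ring).
  rewrite Rpow_mult_distr in HE3, HE4. rewrite <- Rmult_assoc in HE3, HE4.
  set (E := exp (- (d * phil (t - tau) / eps))) in *.
  assert (PE : 0 < E) by apply exp_pos.
  set (c3 := exp (d * a) * (3 / (d * a * p)) ^ 3) in *.
  set (c4 := exp (d * a) * (4 / (d * a * p)) ^ 4) in *.
  set (c := 16 / d ^ 2) in *.
  assert (Pc : 0 < c) by (apply Rdiv_lt_0_compat; [lra|now apply pow_lt]).
  assert (T2 : 0 < tau ^ 2) by now apply pow_lt.
  assert (Pe2 : 0 < eps ^ 2) by now apply pow_lt.
  set (len := phil (t + tau) - phil (t - tau)) in *.
  set (dif := Rabs (phil (t + tau) - 2 * phil t + phil (t - tau))) in *.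
  assert (Pdif : 0 <= dif) by apply Rabs_pos.
  assert (Plen2 : 0 <= len ^ 2) by apply pow2_ge_0.
  split.
  - assert (Q1 : len ^ 2 * (1 + c) <= 16 * K ^ 2 * (1 + c) * tau ^ 2).
    { replace (16 * K ^ 2 * (1 + c) * tau ^ 2) with ((4 * K * tau) ^ 2 * (1 + c)) by ring.
      apply Rmult_le_compat_r; [lra|]. apply pow_incr; lra. }
    assert (Q2 : len ^ 2 * (E / eps ^ 2) <= (36 * K) ^ 2 * c4 * tau ^ 2).
    { replace ((36 * K) ^ 2 * c4 * tau ^ 2)
        with ((36 * K * (eps / s ^ 2) * tau) ^ 2 * (c4 * s ^ 4 / eps ^ 2)) by (field; lra).
      apply Rmult_le_compat; [apply pow2_ge_0| |apply pow_incr; lra|].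
      - left; now apply Rdiv_lt_0_compat.
      - apply Rmult_le_compat_r; [left; now apply Rinv_0_lt_compat|lra]. }
    assert (Q3 : 0 <= 54 * K * c3 + 2 * K * (1 + c)).
    { assert (0 < c3) by (unfold c3; apply Rmult_lt_0_compat; [apply exp_pos|];
        apply pow_lt, Rdiv_lt_0_compat; [lra|repeat apply Rmult_lt_0_compat; lra]).
      nra. }
    apply Rle_trans with (len ^ 2 * (1 + c) + len ^ 2 * (E / eps ^ 2)).
    + rewrite <- Rmult_plus_distr_l. apply Rmult_le_compat_l; [exact Plen2|].
      assert (layer d eps x / eps ^ 2 <= c + E / eps ^ 2); [|lra].
      replace (c + E / eps ^ 2) with ((E + c * eps ^ 2) / eps ^ 2) by (field; lra).
      apply Rmult_le_compat_r; [left; now apply Rinv_0_lt_compat|exact HE].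
    + unfold C_near. fold c3 c4 c. nra.
  - assert (Q1 : dif * (1 + c) <= 2 * K * (1 + c) * tau ^ 2).
    { replace (2 * K * (1 + c) * tau ^ 2) with (2 * K * tau ^ 2 * (1 + c)) by ring.
      apply Rmult_le_compat_r; [lra|exact Dc]. }
    assert (Q2 : dif * (E / eps) <= 54 * K * c3 * tau ^ 2).
    { replace (54 * K * c3 * tau ^ 2)
        with (2 * (27 * K * (eps / s ^ 3)) * tau ^ 2 * (c3 * s ^ 3 / eps)) by (field; lra).
      apply Rmult_le_compat; [exact Pdif| |exact D|].
      - left; now apply Rdiv_lt_0_compat.
      - apply Rmult_le_compat_r; [left; now apply Rinv_0_lt_compat|lra]. }
    assert (Q3 : 0 <= (36 * K) ^ 2 * c4 + 16 * K ^ 2 * (1 + c)).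
    { assert (0 < c4) by (unfold c4; apply Rmult_lt_0_compat; [apply exp_pos|];
        apply pow_lt, Rdiv_lt_0_compat; [lra|repeat apply Rmult_lt_0_compat; lra]).
      assert (0 < K ^ 2) by now apply pow_lt. nra. }
    apply Rle_trans with (dif * (1 + c) + dif * (E / eps)).
    + rewrite <- Rmult_plus_distr_l. apply Rmult_le_compat_l; [exact Pdif|].
      assert (layer d eps x / eps <= c + E / eps); [|lra].
      apply Rle_trans with ((E + c * eps ^ 2) / eps).
      * apply Rmult_le_compat_r; [left; now apply Rinv_0_lt_compat|exact HE].
      * replace ((E + c * eps ^ 2) / eps) with (E / eps + c * eps) by (field; lra). nra.
    + unfold C_near. fold c3 c4 c. nra.
Qed.

(** The few cells around the pole: eps^(1/3) < 3 tau there, so the steps are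
    O(tau^2) themselves. *)
Lemma resolved_gap : t - tau < alpha p eps -> p - (t - tau) < 3 * tau ->
  resolved d eps C_gap tau (phil (t - tau)) (phil t) (phil (t + tau)).
Proof.
  intros H Hs. right. intros x Hx.
  assert (Hal : alpha p eps = p - e) by now apply alpha_root.
  destruct eps_bounds as [Pe Pe1].
  pose proof K_pos as PK. pose proof (phil_cell x Hx) as Ux.
  set (s := p - (t - tau)) in *.
  assert (Ps : e < s) by (unfold s; lra).
  assert (L : phil (t + tau) - phil (t - tau) <= 10 * K * tau ^ 2).
  { replace (10 * K * tau ^ 2) with (5 * K * tau * (t + tau - (t - tau))) by ring.
    apply (phi_left_increment a p e eps); auto; try lra.
    intros r Hr. eapply Rle_trans; [apply (left1_le a p e); auto; lra|]. fold K.
    replace (5 * K * tau) with (K * (3 * tau + 2 * tau)) by ring.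
    apply Rmult_le_compat_l; [lra|]. apply Rplus_le_compat; [lra|].
    apply Rmax_lub; lra. }
  assert (HE : layer d eps x <= exp (- (d * phil (t - tau) / eps)) + 16 / d ^ 2 * eps ^ 2)
    by (apply layer_left_half; auto; lra).
  assert (HE2 := exp_near 2 (t - tau) ltac:(lia) ltac:(lra) ltac:(lra)).
  fold s in HE2. replace (INR 2) with 2 in HE2 by (simpl; ring).
  rewrite Rpow_mult_distr in HE2. rewrite <- Rmult_assoc in HE2.
  unfold C_gap. set (c2 := exp (d * a) * (2 / (d * a * p)) ^ 2) in *.
  assert (Pc2 : 0 < c2) by (unfold c2; apply Rmult_lt_0_compat; [apply exp_pos|];
        apply pow_lt, Rdiv_lt_0_compat; [lra|repeat apply Rmult_lt_0_compat; lra]).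
  assert (Pc : 0 < 16 / d ^ 2) by (apply Rdiv_lt_0_compat; [lra|now apply pow_lt]).
  assert (S2 : s ^ 2 <= 9 * tau ^ 2).
  { replace (9 * tau ^ 2) with ((3 * tau) ^ 2) by ring. apply pow_incr; lra. }
  assert (E2 : eps ^ 2 <= 9 * tau ^ 2).
  { apply Rle_trans with (e ^ 2).
    - apply pow_incr; split; [lra|]. rewrite Heps. assert (e * e <= 1) by nra. simpl. nra.
    - apply Rle_trans with (s ^ 2); [apply pow_incr; lra|exact S2]. }
  assert (c2 * s ^ 2 <= c2 * (9 * tau ^ 2)) by (apply Rmult_le_compat_l; lra).
  assert (16 / d ^ 2 * eps ^ 2 <= 16 / d ^ 2 * (9 * tau ^ 2)) by (apply Rmult_le_compat_l; lra).
  lra.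
Qed.

End Cells.

Definition C_centre : R := 3 / (1 / 2 - p) ^ 2.

(** At the centre the two steps are equal by symmetry, but for small N the cell
    pair may reach into both layers; then tau is bounded below. *)
Lemma resolved_centre tau : 0 < tau <= 1 / 2 ->
  resolved d eps (Rmax (C_far) C_centre) tau
    (phil (1 / 2 - tau)) (1 / 2) (1 - phil (1 / 2 - tau)).
Proof.
  intros Htau.
  destruct eps_bounds as [Pe Pe1].
  assert (Hal : alpha p eps = p - e) by now apply alpha_root.
  assert (Hhalf : phil (1 / 2) = 1 / 2) by (apply (phi_left_half a p e); auto; lra).
  assert (Hlt : phil (1 / 2 - tau) < 1 / 2).
  { rewrite <- Hhalf. apply (phi_left_increasing a p e eps); auto; lra. }
  assert (Hge : 0 <= phil (1 / 2 - tau)).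
  { rewrite <- (phi_left_0 a p e eps); auto; try lra.
    destruct (proj2 Htau) as [H|H].
    - left. apply (phi_left_increasing a p e eps); auto; lra.
    - rewrite H. unfold phil. right. f_equal. lra. }
  assert (PT : 0 < tau ^ 2) by (apply pow_lt; lra).
  destruct (Rle_lt_dec (alpha p eps) (1 / 2 - tau)) as [H|H].
  - apply (resolved_weaken _ _ C_far); [apply Rmax_l|].
    left. intros x Hx.
    replace (1 - phil (1 / 2 - tau) - 2 * (1 / 2) + phil (1 / 2 - tau)) with 0 by field.
    set (Q := far_constant + 16 / d ^ 2).
    assert (Pe2 : 0 < eps ^ 2) by now apply pow_lt.
    assert (HL : forall z, phil (1 / 2 - tau) <= z <= 1 / 2 ->
      layer d eps z / eps ^ 2 <= Q).
    { intros z Hz. apply Rmult_le_reg_r with (eps ^ 2); [exact Pe2|].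
      unfold Rdiv. rewrite Rmult_assoc, Rinv_l, Rmult_1_r by lra.
      eapply Rle_trans; [apply (layer_left_half d eps (phil (1 / 2 - tau))); auto; lra|].
      pose proof (exp_far (1 / 2 - tau) H ltac:(lra)). unfold Q. lra. }
    assert (HLx : 0 < layer d eps x / eps ^ 2 <= Q).
    { split; [apply Rdiv_lt_0_compat; auto using layer_pos|].
      destruct (Rle_dec x (1 / 2)) as [Hh|Hh]; [apply HL; lra|].
      rewrite <- layer_sym. apply HL; lra. }
    pose proof K_pos as PK. assert (0 < K ^ 2) by now apply pow_lt.
    assert (L : 0 <= 1 - phil (1 / 2 - tau) - phil (1 / 2 - tau) <= 4 * K * tau).
    { split; [lra|].
      assert (phil (1 / 2) - phil (1 / 2 - tau) <= 2 * K * (1 / 2 - (1 / 2 - tau))).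
      { apply (phi_left_increment a p e eps); auto; try lra.
        intros r Hr. apply (left1_le_const a p e); auto; lra. }
      lra. }
    unfold C_far. fold Q.
    assert (0 < K ^ 2 * tau ^ 2) by nra. assert (0 < K * tau ^ 2) by nra.
    split.
    + apply Rle_trans with (16 * K ^ 2 * tau ^ 2 * (1 + Q)); [|nra].
      apply Rmult_le_compat; [apply pow2_ge_0|lra| |lra].
      replace (16 * K ^ 2 * tau ^ 2) with ((4 * K * tau) ^ 2) by ring.
      apply pow_incr; exact L.
    + rewrite Rabs_R0, Rmult_0_l. apply Rmult_le_pos; [|lra].
      apply Rmult_le_pos; lra.
  - apply (resolved_weaken _ _ C_centre); [apply Rmax_r|].
    right. intros x Hx.
    assert (layer d eps x <= 2) by (apply layer_le_2; auto; unfold unit_interval; lra).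
    apply Rle_trans with 3; [lra|].
    assert (P2 : 0 < (1 / 2 - p) ^ 2) by (apply pow_lt; lra).
    assert (T : (1 / 2 - p) ^ 2 <= tau ^ 2) by (apply pow_incr; lra).
    unfold C_centre. apply Rmult_le_reg_r with ((1 / 2 - p) ^ 2); [exact P2|].
    replace (3 / (1 / 2 - p) ^ 2 * tau ^ 2 * (1 / 2 - p) ^ 2) with (3 * tau ^ 2)
      by (field; lra).
    lra.
Qed.

Definition C_mesh : R := Rmax (Rmax C_far C_centre) (Rmax C_near C_gap).

Lemma C_mesh_pos : 0 < C_mesh.
Proof.
  unfold C_mesh. eapply Rlt_le_trans; [|apply Rmax_l].
  eapply Rlt_le_trans; [|apply Rmax_r].
  unfold C_centre. apply Rdiv_lt_0_compat; [lra|apply pow_lt; lra].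
Qed.

Lemma resolved_left tau t : 0 < tau -> 0 <= t - tau -> t + tau <= 1 / 2 ->
  resolved d eps C_mesh tau (phil (t - tau)) (phil t) (phil (t + tau)).
Proof.
  intros H H0 H1. unfold C_mesh.
  destruct (Rle_lt_dec (alpha p eps) (t - tau)) as [Q|Q].
  - apply (resolved_weaken _ _ C_far); [eapply Rle_trans; apply Rmax_l|].
    now apply resolved_far.
  - destruct (Rle_lt_dec (3 * tau) (p - (t - tau))) as [Q'|Q'].
    + apply (resolved_weaken _ _ C_near);
        [eapply Rle_trans; [apply Rmax_l|apply Rmax_r]|].
      now apply resolved_near.
    + apply (resolved_weaken _ _ C_gap); [eapply Rle_trans; apply Rmax_r|].
      now apply resolved_gap.
Qed.

Lemma phi_on_left t : t <= 1 / 2 -> phi a p eps t = phil t.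
Proof. intros Ht. unfold phi. now destruct Rle_dec. Qed.

Lemma phi_reflect t : phi a p eps (1 - t) = 1 - phi a p eps t.
Proof.
  unfold phi. destruct (Rle_dec (1 - t) (1 / 2)), (Rle_dec t (1 / 2)); try lra.
  - replace (1 - t) with (1 / 2) by lra. replace t with (1 / 2) by lra.
    rewrite (phi_left_half a p e); auto; lra.
  - replace (1 - (1 - t)) with t by ring. reflexivity.
Qed.

Lemma phi_increasing s t : 0 <= s -> s < t -> t <= 1 -> phi a p eps s < phi a p eps t.
Proof.
  assert (Left : forall s t, 0 <= s -> s < t -> t <= 1 / 2 ->
    phi a p eps s < phi a p eps t).
  { intros s' t' H0 H1 H2. rewrite !phi_on_left by lra.
    apply (phi_left_increasing a p e eps); auto; lra. }
  assert (Right : forall s t, 1 / 2 <= s -> s < t -> t <= 1 ->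
    phi a p eps s < phi a p eps t).
  { intros s' t' H0 H1 H2. pose proof (Left (1 - t') (1 - s')) as H.
    rewrite !phi_reflect in H. lra. }
  intros H0 H1 H2.
  destruct (Rle_lt_dec t (1 / 2)); [now apply Left|].
  destruct (Rle_lt_dec (1 / 2) s); [now apply Right|].
  apply Rlt_trans with (phi a p eps (1 / 2)); [apply Left|apply Right]; lra.
Qed.

Lemma phi_0 : phi a p eps 0 = 0.
Proof. rewrite phi_on_left by lra. apply (phi_left_0 a p e); auto; lra. Qed.

Lemma phi_1 : phi a p eps 1 = 1.
Proof. replace 1 with (1 - 0) at 1 by ring. rewrite phi_reflect, phi_0. ring. Qed.

Section Grid.

Variable N : nat.
Hypothesis HN : (0 < N)%nat.

Let x : nat -> R := mesh a p eps N.

Lemma mesh_0 : x 0%nat = 0.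
Proof. unfold x, mesh. replace (INR 0 / INR N) with 0 by (simpl; unfold Rdiv; ring).
  apply phi_0. Qed.

Lemma mesh_N : x N = 1.
Proof.
  unfold x, mesh. replace (INR N / INR N) with 1; [apply phi_1|].
  field. apply not_0_INR; lia.
Qed.

Lemma mesh_increasing i : (i < N)%nat -> x i < x (S i).
Proof.
  intros Hi. assert (P : 0 < INR N) by now apply lt_0_INR.
  unfold x, mesh. apply phi_increasing.
  - apply Rdiv_le_0_compat; [apply pos_INR|exact P].
  - apply Rmult_lt_compat_r; [now apply Rinv_0_lt_compat|]. apply lt_INR; lia.
  - apply Rmult_le_reg_r with (INR N); [exact P|].
    unfold Rdiv. rewrite Rmult_assoc, Rinv_l, Rmult_1_r, Rmult_1_l by lra.
    apply le_INR; lia.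
Qed.

Lemma mesh_unit i : (i <= N)%nat -> unit_interval (x i).
Proof.
  intros Hi. split.
  - rewrite <- mesh_0. induction i as [|i IH]; [right; reflexivity|].
    pose proof (mesh_increasing i ltac:(lia)). specialize (IH ltac:(lia)). lra.
  - rewrite <- mesh_N. replace N with (i + (N - i))%nat by lia.
    assert (Q : (i + (N - i) <= N)%nat) by lia. revert Q.
    induction (N - i)%nat as [|j IH]; intros Q.
    + rewrite Nat.add_0_r. right; reflexivity.
    + rewrite Nat.add_succ_r. pose proof (mesh_increasing (i + j) ltac:(lia)).
      specialize (IH ltac:(lia)). lra.
Qed.

Lemma mesh_reflect i : (i <= N)%nat -> x (N - i)%nat = 1 - x i.
Proof.
  intros Hi. assert (P : 0 < INR N) by now apply lt_0_INR.
  unfold x, mesh. rewrite <- phi_reflect. f_equal. rewrite minus_INR by lia. field. lra.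
Qed.

Lemma mesh_resolved i : Nat.Even N -> (0 < i < N)%nat ->
  resolved d eps C_mesh (/ INR N) (x (i - 1)%nat) (x i) (x (i + 1)%nat).
Proof.
  intros [n Hn] Hi. assert (P : 0 < INR N) by now apply lt_0_INR.
  assert (PI : 0 < / INR N) by now apply Rinv_0_lt_compat.
  assert (Pred : forall j, (0 < j)%nat -> INR (j - 1) / INR N = INR j / INR N - / INR N).
  { intros j Hj. rewrite minus_INR by lia. simpl. field. lra. }
  assert (Succ : forall j, INR (j + 1) / INR N = INR j / INR N + / INR N).
  { intros j. rewrite plus_INR. simpl. field. lra. }
  assert (Half : INR n / INR N = 1 / 2).
  { rewrite Hn, mult_INR. simpl INR.
    assert (INR n <> 0) by (apply not_0_INR; lia). field. lra. }
  assert (Left : forall j, (0 < j < n)%nat ->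
    resolved d eps C_mesh (/ INR N) (x (j - 1)%nat) (x j) (x (j + 1)%nat)).
  { intros j Hj.
    assert (H0 : 0 <= INR (j - 1) / INR N)
      by (apply Rdiv_le_0_compat; [apply pos_INR|exact P]).
    assert (H1 : INR (j + 1) / INR N <= 1 / 2).
    { rewrite <- Half. apply Rmult_le_compat_r; [lra|]. apply le_INR; lia. }
    unfold x, mesh. rewrite Pred in * by lia. rewrite Succ in *.
    rewrite !phi_on_left by lra. now apply resolved_left. }
  destruct (Compare_dec.lt_eq_lt_dec i n) as [[H|H]|H].
  - apply Left; lia.
  - subst i.
    replace (x (n + 1)%nat) with (1 - x (n - 1)%nat)
      by (rewrite <- mesh_reflect by lia; f_equal; lia).
    assert (H0 : 0 <= INR (n - 1) / INR N)
      by (apply Rdiv_le_0_compat; [apply pos_INR|exact P]).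
    unfold x, mesh. rewrite Pred in * by lia. rewrite Half in *.
    rewrite !phi_on_left by lra.
    replace (phil (1 / 2)) with (1 / 2) by (symmetry; apply (phi_left_half a p e); auto; lra).
    apply (resolved_weaken _ _ (Rmax C_far C_centre)); [apply Rmax_l|].
    apply resolved_centre; lra.
  - pose proof (resolved_reflect _ _ _ _ _ _ _ (Left (N - i)%nat ltac:(lia))) as R.
    rewrite <- !mesh_reflect in R by lia.
    replace (N - (N - i + 1))%nat with (i - 1)%nat in R by lia.
    replace (N - (N - i))%nat with i in R by lia.
    replace (N - (N - i - 1))%nat with (i + 1)%nat in R by lia.
    exact R.
Qed.

End Grid.

End Resolution.

(** * Consistency and stability *)

Lemma delta_d_half_tanh gamma eps x i :
  beta gamma eps * step x (i - 1) > 0 ->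
  delta_d gamma eps x i = half_tanh (beta gamma eps * step x (i - 1)).
Proof.
  intros H. unfold delta_d, d_coef, a_coef, half_tanh, tanh.
  pose proof (sinh_pos _ H). pose proof (cosh_ge_1 (beta gamma eps * step x (i - 1))).
  field. lra.
Qed.

(** For the exact solution the bracket in the first part is the truncation error of
    the exponentially fitted three-point scheme, and the second part is a second
    difference of g; both are small when g is nearly affine around the point. *)
Lemma F_interior_split (f : R -> R -> R) (gamma q eps : R) (x u : nat -> R) (i : nat) :
  0 < gamma -> (0 < i)%nat ->
  0 < beta gamma eps * step x (i - 1) -> 0 < beta gamma eps * step x i ->
  let g j := gamma * u j - f (x j) (u j) in
  let H := beta gamma eps * step x (i - 1) in
  let K := beta gamma eps * step x i in
  F_interior f gamma q eps x u i =
  (q + 2) * (gamma / (half_tanh H + half_tanh K)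
             * stencil H K (u (i - 1)%nat) (u i) (u (i + 1)%nat) + g i)
  + (g (i - 1)%nat - 2 * g i + g (i + 1)%nat).
Proof.
  intros Hg Hi HH HK g H K. unfold F_interior.
  rewrite !delta_d_half_tanh by (rewrite ?Nat.add_sub; assumption).
  unfold d_coef, a_coef, tanh, stencil, g.
  rewrite !Nat.add_sub. fold H K.
  pose proof (half_tanh_pos H HH) as TH. pose proof (half_tanh_pos K HK) as TK.
  pose proof (sinh_pos H HH). pose proof (sinh_pos K HK).
  pose proof (cosh_ge_1 H). pose proof (cosh_ge_1 K).
  replace (/ (sinh H / cosh H)) with (half_tanh H + / sinh H)
    by (unfold half_tanh; field; lra).
  replace (/ (sinh K / cosh K)) with (half_tanh K + / sinh K)
    by (unfold half_tanh; field; lra).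
  field. lra.
Qed.

Section Consistency.

Variables (g g1 g2 : R -> R) (A C d eps tau xm x0 xp : R).
Hypothesis Hd : 0 < d.
Hypothesis Heps : 0 < eps.
Hypothesis Hg : forall x, unit_interval x -> D_in g g1 unit_interval x.
Hypothesis Hg1 : forall x, unit_interval x -> D_in g1 g2 unit_interval x.
Hypothesis HA1 : forall x, unit_interval x ->
  Rabs (g1 x) <= A * (1 + layer d eps x / eps).
Hypothesis HA2 : forall x, unit_interval x ->
  Rabs (g2 x) <= A * (1 + layer d eps x / eps ^ 2).
Hypothesis HA : 0 < A.
Hypothesis Hm : 0 <= xm.
Hypothesis Hm0 : xm < x0.
Hypothesis H0p : x0 < xp.
Hypothesis Hp1 : xp <= 1.

(** The bound for g' is the derivative of A (z + (eps/d^2) layer'), because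
    layer'' = (d^2/eps^2) layer; and |layer'| is at most (d/eps) layer. *)
Lemma oscillation_bound (B : R) :
  (forall x, xm <= x <= xp -> xp - xm + layer d eps x <= B) ->
  forall z, xm <= z <= xp -> Rabs (g z - g x0) <= A * (1 + 2 / d) * B.
Proof.
  intros HB.
  set (P := fun z => A * (z + eps / d ^ 2 * layer1 d eps z)).
  set (P1 := fun z => A * (1 + eps / d ^ 2 * (d ^ 2 / eps ^ 2 * layer d eps z))).
  assert (DP : forall z, D_in P P1 unit_interval z).
  { intros z. unfold P, P1.
    apply (Dmult_const _ (fun z => z + eps / d ^ 2 * layer1 d eps z)
      (fun z => 1 + eps / d ^ 2 * (d ^ 2 / eps ^ 2 * layer d eps z))).
    apply Dadd; [apply Dx|].
    apply (Dmult_const _ (layer1 d eps) (fun z => d ^ 2 / eps ^ 2 * layer d eps z)).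
    now apply layer1_D_in. }
  assert (EP : forall z, P1 z = A * (1 + layer d eps z / eps)).
  { intros z. unfold P1. field. lra. }
  assert (Osc : forall s t, xm <= s -> s <= t -> t <= xp ->
    Rabs (g t - g s) <= P t - P s).
  { intros s t Hs Hst Ht. apply Rabs_le_of_signs. intros sg Hsg.
    assert (P s + sg * g s <= P t + sg * g t); [|lra].
    apply (monotone_of_derivative (fun z => P z + sg * g z) (fun z => P1 z + sg * g1 z));
      try lra.
    - intros z Uz. apply Dadd; [apply DP|]. apply (Dmult_const _ g g1); auto.
    - intros z Hz. rewrite EP.
      assert (B1 := HA1 z ltac:(unfold unit_interval; lra)).
      apply Rabs_le_between in B1. destruct Hsg; subst; lra. }
  assert (L1 : forall z, Rabs (eps / d ^ 2 * layer1 d eps z) <= / d * layer d eps z).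
  { intros z. unfold layer1, layer.
    replace (eps / d ^ 2 * (d / eps * (exp (- (d * (1 - z) / eps)) - exp (- (d * z / eps)))))
      with (/ d * (exp (- (d * (1 - z) / eps)) - exp (- (d * z / eps)))) by (field; lra).
    rewrite Rabs_mult. rewrite Rabs_pos_eq by (left; now apply Rinv_0_lt_compat).
    apply Rmult_le_compat_l; [left; now apply Rinv_0_lt_compat|].
    pose proof (exp_pos (- (d * (1 - z) / eps))). pose proof (exp_pos (- (d * z / eps))).
    apply Rabs_le; lra. }
  assert (Fin : forall s t, xm <= s -> s <= t -> t <= xp ->
    P t - P s <= A * (1 + 2 / d) * B).
  { intros s t Hs Hst Ht. unfold P.
    pose proof (L1 s) as Ls. pose proof (L1 t) as Lt.
    apply Rabs_le_between in Ls. apply Rabs_le_between in Lt.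
    pose proof (HB s ltac:(lra)) as Bs. pose proof (HB t ltac:(lra)) as Bt.
    pose proof (layer_pos d eps s). pose proof (layer_pos d eps t).
    assert (Id : 0 < / d) by now apply Rinv_0_lt_compat.
    assert (/ d * layer d eps s <= / d * B) by (apply Rmult_le_compat_l; lra).
    assert (/ d * layer d eps t <= / d * B) by (apply Rmult_le_compat_l; lra).
    rewrite Rmult_assoc, <- Rmult_minus_distr_l. apply Rmult_le_compat_l; [lra|].
    replace ((1 + 2 / d) * B) with (B + / d * B + / d * B) by (field; lra). lra. }
  intros z Hz. destruct (Rle_lt_dec z x0).
  - rewrite Rabs_minus_sym. eapply Rle_trans; [apply Osc|apply Fin]; lra.
  - eapply Rle_trans; [apply Osc|apply Fin]; lra.
Qed.

(** Where the steps are small relative to the derivatives the tangent serves as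
    affine function, and in the gap between the layer and the smooth part, where
    g'' times the square of the step is not small, a constant does. *)
Lemma affine_approximation :
  0 < C -> resolved d eps C tau xm x0 xp ->
  exists s M, (forall z, xm <= z <= xp -> Rabs (g z - g x0 - s * (z - x0)) <= M) /\
    M + Rabs s * Rabs (xp - 2 * x0 + xm) <= A * (2 + 2 / d) * (C * tau ^ 2).
Proof.
  intros HC [H|H].
  - exists (g1 x0), (A * (C * tau ^ 2)). split.
    + intros z Hz.
      assert (PL : 0 < (xp - xm) ^ 2) by (apply pow_lt; lra).
      eapply Rle_trans.
      * apply (taylor2 g g1 g2 xm xp (A * (C * tau ^ 2) / (xp - xm) ^ 2)); auto; try lra.
        intros s Hs. eapply Rle_trans; [apply HA2; unfold unit_interval; lra|].
        destruct (H s Hs) as [Hs2 _].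
        apply Rmult_le_reg_r with ((xp - xm) ^ 2); [exact PL|].
        unfold Rdiv at 2. rewrite (Rmult_assoc _ (/ _)), Rinv_l, Rmult_1_r by lra.
        rewrite Rmult_assoc. apply Rmult_le_compat_l; lra.
      * unfold Rdiv. rewrite Rmult_assoc. rewrite <- (Rmult_1_r (A * (C * tau ^ 2))) at 2.
        apply Rmult_le_compat_l.
        { apply Rmult_le_pos; [lra|]. apply Rmult_le_pos; [lra|apply pow2_ge_0]. }
        apply Rmult_le_reg_l with ((xp - xm) ^ 2); [exact PL|].
        rewrite <- Rmult_assoc, Rinv_r, Rmult_1_l, Rmult_1_r by lra. nra.
    + destruct (H x0 ltac:(lra)) as [_ Hd0].
      assert (B1 := HA1 x0 ltac:(unfold unit_interval; lra)).
      assert (Rabs (g1 x0) * Rabs (xp - 2 * x0 + xm) <= A * (C * tau ^ 2)).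
      { apply Rle_trans with (A * (1 + layer d eps x0 / eps) * Rabs (xp - 2 * x0 + xm)).
        - apply Rmult_le_compat_r; [apply Rabs_pos|exact B1].
        - rewrite Rmult_assoc. apply Rmult_le_compat_l; lra. }
      assert (0 <= A * (C * tau ^ 2)).
      { apply Rmult_le_pos; [lra|]. apply Rmult_le_pos; [lra|apply pow2_ge_0]. }
      assert (0 < 2 / d) by (apply Rdiv_lt_0_compat; lra).
      nra.
  - exists 0, (A * (1 + 2 / d) * (C * tau ^ 2)). split.
    + intros z Hz. rewrite Rmult_0_l, Rminus_0_r. now apply oscillation_bound.
    + rewrite Rabs_R0, Rmult_0_l.
      assert (0 <= A * (C * tau ^ 2)).
      { apply Rmult_le_pos; [lra|]. apply Rmult_le_pos; [lra|apply pow2_ge_0]. }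
      nra.
Qed.

End Consistency.

Lemma argmax_abs (e : nat -> R) (N : nat) :
  exists j, (j <= N)%nat /\ forall i, (i <= N)%nat -> Rabs (e i) <= Rabs (e j).
Proof.
  induction N as [|N [j [Hj H]]].
  - exists 0%nat. split; [lia|]. intros i Hi. replace i with 0%nat by lia. lra.
  - destruct (Rle_lt_dec (Rabs (e (S N))) (Rabs (e j))) as [Q|Q].
    + exists j. split; [lia|]. intros i Hi.
      destruct (Nat.eq_dec i (S N)) as [->|]; [exact Q|]. apply H; lia.
    + exists (S N). split; [lia|]. intros i Hi.
      destruct (Nat.eq_dec i (S N)) as [->|]; [lra|].
      assert (Rabs (e i) <= Rabs (e j)) by (apply H; lia). lra.
Qed.

(** At an entry of largest modulus both differences have the sign opposite to it,
    so they can only add to the zero-order term. *)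
Lemma discrete_maximum_principle (e : nat -> R) (N : nat) (c0 T : R) :
  0 < c0 -> 0 <= T -> e 0%nat = 0 -> e N = 0 ->
  (forall i, (0 < i < N)%nat -> exists P Q c, 0 <= P /\ 0 <= Q /\ c0 <= c /\
     Rabs (P * (e (i - 1)%nat - e i) + Q * (e (i + 1)%nat - e i) - c * e i) <= T) ->
  forall i, (i <= N)%nat -> Rabs (e i) <= T / c0.
Proof.
  intros Hc HT E0 EN H i Hi.
  destruct (argmax_abs e N) as [j [Hj Hmax]].
  eapply Rle_trans; [now apply Hmax|].
  assert (P0 : 0 <= T / c0) by (apply Rdiv_le_0_compat; lra).
  destruct (Nat.eq_dec j 0) as [->|J0]; [rewrite E0, Rabs_R0; exact P0|].
  destruct (Nat.eq_dec j N) as [->|JN]; [rewrite EN, Rabs_R0; exact P0|].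
  destruct (H j ltac:(lia)) as [P [Q [c [HP [HQ [Hc0 HR]]]]]].
  assert (M1 := Hmax (j - 1)%nat ltac:(lia)). assert (M2 := Hmax (j + 1)%nat ltac:(lia)).
  apply Rmult_le_reg_r with c0; [exact Hc|].
  unfold Rdiv. rewrite Rmult_assoc, Rinv_l, Rmult_1_r by lra.
  apply Rabs_le_between in HR. apply Rabs_le_between in M1. apply Rabs_le_between in M2.
  unfold Rabs in *. destruct (Rcase_abs (e j)).
  - assert (0 <= P * (e (j - 1)%nat - e j)) by (apply Rmult_le_pos; lra).
    assert (0 <= Q * (e (j + 1)%nat - e j)) by (apply Rmult_le_pos; lra). nra.
  - assert (P * (e (j - 1)%nat - e j) <= 0) by nra.
    assert (Q * (e (j + 1)%nat - e j) <= 0) by nra. nra.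
Qed.

Lemma Rmax_N_le (u : nat -> R) (N : nat) (b : R) :
  (forall i, (i <= N)%nat -> u i <= b) -> Rmax_N u N <= b.
Proof.
  induction N as [|N IH]; intros H; simpl; [apply H; lia|].
  apply Rmax_lub; [apply H; lia|]. apply IH. intros i Hi; apply H; lia.
Qed.

Lemma Ck_strip_on_strip k h : Ck_strip k h -> on_strip h.
Proof. destruct k; intros H; apply H. Qed.

Lemma smooth_monotone_of_Ck k f m gamma :
  (2 <= k)%nat -> Ck_strip k f -> 0 < m ->
  (forall x v, 0 <= x <= 1 -> m <= Derive (f x) v) ->
  (forall x v, 0 <= x <= 1 -> Derive (f x) v <= gamma) ->
  exists fx fv fxx fxv fvx fvv, smooth_monotone f fx fv fxx fxv fvx fvv m gamma.
Proof.
  intros Hk Hf Hm Hlo Hhi. destruct k as [|[|k]]; try lia.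
  destruct Hf as [Cf [fx [fv [Pf [[Cfx [fxx [fxv [Pfx [Cfxx Cfxv]]]]]
    [Cfv [fvx [fvv [Pfv [Cfvx Cfvv]]]]]]]]]].
  exists fx, fv, fxx, fxv, fvx, fvv. split; try assumption;
    try (eapply Ck_strip_on_strip; eassumption).
  intros x v Hx. rewrite <- (is_derive_unique _ _ _ (proj2 (Pf x v Hx))).
  split; [now apply Hlo|now apply Hhi].
Qed.

Lemma solution_of_bvp f eps y :
  0 < eps < 1 -> bvp_solution f eps y -> exists y1, solution f eps y y1.
Proof.
  intros He [[y1 [y2 H]] [H0 H1]]. exists y1. split; auto.
  - intros x Hx. now destruct (H x Hx).
  - intros x Hx. destruct (H x Hx) as [_ [D E]].
    apply (D_in_ext y2); [|exact D]. rewrite <- E. field. lra.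
Qed.

(** The error equation. The coefficients of the neighbours stay nonnegative
    because the weight of u_{i-1} - u_i is at least gamma, which dominates f_v. *)
Lemma error_equation f fv m gamma q eps (x u w : nat -> R) (i : nat) :
  0 < gamma -> 0 < m -> 0 < q -> (0 < i)%nat ->
  0 < beta gamma eps * step x (i - 1) -> 0 < beta gamma eps * step x i ->
  (forall j v, (j <= i + 1)%nat -> is_derive (f (x j)) v (fv (x j) v)) ->
  (forall j v, (j <= i + 1)%nat -> m <= fv (x j) v <= gamma) ->
  exists P Q c, 0 <= P /\ 0 <= Q /\ (q + 2) * m <= c /\
    F_interior f gamma q eps x u i - F_interior f gamma q eps x w i
    = P * ((u (i - 1)%nat - w (i - 1)%nat) - (u i - w i))
      + Q * ((u (i + 1)%nat - w (i + 1)%nat) - (u i - w i)) - c * (u i - w i).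
Proof.
  intros Hg Hm Hq Hi HH HK Hder Hb.
  rewrite !F_interior_split by assumption. cbv zeta.
  set (H := beta gamma eps * step x (i - 1)) in *.
  set (K := beta gamma eps * step x i) in *.
  pose proof (half_tanh_pos H HH) as TH. pose proof (half_tanh_pos K HK) as TK.
  pose proof (sinh_pos H HH) as SH. pose proof (sinh_pos K HK) as SK.
  destruct (increment_in_v f fv m gamma (x (i - 1)%nat) (u (i - 1)%nat) (w (i - 1)%nat))
    as [c1 [Hc1 E1]]; try (intros; (apply Hder || apply Hb); lia).
  destruct (increment_in_v f fv m gamma (x i) (u i) (w i))
    as [c2 [Hc2 E2]]; try (intros; (apply Hder || apply Hb); lia).
  destruct (increment_in_v f fv m gamma (x (i + 1)%nat) (u (i + 1)%nat) (w (i + 1)%nat))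
    as [c3 [Hc3 E3]]; try (intros; (apply Hder || apply Hb); lia).
  set (D := half_tanh H + half_tanh K) in *.
  assert (PD : 0 < D) by (unfold D; lra).
  assert (PG : 0 < (q + 2) * (gamma / D)).
  { apply Rmult_lt_0_compat; [lra|now apply Rdiv_lt_0_compat]. }
  assert (0 < (q + 2) * (gamma / D) * / sinh H)
    by (apply Rmult_lt_0_compat; [exact PG|now apply Rinv_0_lt_compat]).
  assert (0 < (q + 2) * (gamma / D) * / sinh K)
    by (apply Rmult_lt_0_compat; [exact PG|now apply Rinv_0_lt_compat]).
  exists ((q + 2) * (gamma / D) * / sinh H + gamma - c1),
    ((q + 2) * (gamma / D) * / sinh K + gamma - c3), (c1 + q * c2 + c3).
  repeat split; try lra; [nra|].
  replace (f (x (i - 1)%nat) (u (i - 1)%nat))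
    with (f (x (i - 1)%nat) (w (i - 1)%nat) + c1 * (u (i - 1)%nat - w (i - 1)%nat)) by lra.
  replace (f (x i) (u i)) with (f (x i) (w i) + c2 * (u i - w i)) by lra.
  replace (f (x (i + 1)%nat) (u (i + 1)%nat))
    with (f (x (i + 1)%nat) (w (i + 1)%nat) + c3 * (u (i + 1)%nat - w (i + 1)%nat)) by lra.
  unfold stencil. fold D. field. lra.
Qed.

(** The fitted scheme contributes q + 2 times the affine approximation error, and
    the second difference twice that error. *)
Lemma truncation_error f gamma q eps (y y1 : R -> R) (x : nat -> R) (i : nat) (s M : R) :
  0 < gamma -> 0 < q -> (0 < i)%nat -> solution f eps y y1 ->
  0 <= x (i - 1)%nat -> x (i - 1)%nat < x i -> x i < x (i + 1)%nat -> x (i + 1)%nat <= 1 ->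
  (forall z, x (i - 1)%nat <= z <= x (i + 1)%nat ->
     Rabs (reduced f gamma y z - reduced f gamma y (x i) - s * (z - x i)) <= M) ->
  Rabs (F_interior f gamma q eps x (fun j => y (x j)) i)
  <= (q + 4) * (M + Rabs s * Rabs (x (i + 1)%nat - 2 * x i + x (i - 1)%nat)).
Proof.
  intros Hg Hq Hi Y H0 H1 H2 H3 HM.
  destruct (sol_eps _ _ _ _ Y) as [He He1].
  assert (Hb : 0 < beta gamma eps)
    by (unfold beta; apply Rdiv_lt_0_compat; [now apply sqrt_lt_R0|lra]).
  assert (Eh : step x (i - 1) = x i - x (i - 1)%nat)
    by (unfold step; f_equal; f_equal; lia).
  assert (Ek : step x i = x (i + 1)%nat - x i)
    by (unfold step; f_equal; f_equal; lia).
  rewrite F_interior_split by (auto; rewrite ?Eh, ?Ek; apply Rmult_lt_0_compat; lra).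
  cbv zeta. rewrite Eh, Ek.
  set (xm := x (i - 1)%nat) in *. set (x0 := x i) in *. set (xp := x (i + 1)%nat) in *.
  assert (St := stencil_truncation gamma (beta gamma eps) M s x0 (x0 - xm) (xp - x0)
    y y1 (reduced f gamma y) Hg Hb ltac:(lra) ltac:(lra)).
  replace (x0 - (x0 - xm)) with xm in St by ring.
  replace (x0 + (xp - x0)) with xp in St by ring.
  replace (xp - x0 - (x0 - xm)) with (xp - 2 * x0 + xm) in St by ring.
  assert (Sb : Rabs (gamma / (half_tanh (beta gamma eps * (x0 - xm))
      + half_tanh (beta gamma eps * (xp - x0)))
      * stencil (beta gamma eps * (x0 - xm)) (beta gamma eps * (xp - x0)) (y xm) (y x0) (y xp)
      + reduced f gamma y x0) <= M + Rabs s * Rabs (xp - 2 * x0 + xm)).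
  { apply St; auto.
    - intros z Uz. now apply (sol_y _ _ _ _ Y).
    - intros z Uz. apply (D_in_ext (fun t => / eps ^ 2 * f t (y t)));
        [|now apply (sol_y1 _ _ _ _ Y)].
      unfold reduced. replace (beta gamma eps ^ 2) with (gamma / eps ^ 2).
      + field. lra.
      + unfold beta. replace ((sqrt gamma / eps) ^ 2) with (sqrt gamma ^ 2 / eps ^ 2)
          by (field; lra). rewrite pow2_sqrt; lra. }
  clear St.
  change (gamma * y x0 - f x0 (y x0)) with (reduced f gamma y x0).
  change (gamma * y xm - f xm (y xm)) with (reduced f gamma y xm).
  change (gamma * y xp - f xp (y xp)) with (reduced f gamma y xp).
  set (W := gamma / _ * stencil _ _ _ _ _ + reduced f gamma y x0) in *.
  set (dif := xp - 2 * x0 + xm) in *.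
  replace (reduced f gamma y xm - 2 * reduced f gamma y x0 + reduced f gamma y xp)
    with ((reduced f gamma y xm - reduced f gamma y x0 - s * (xm - x0))
          + (reduced f gamma y xp - reduced f gamma y x0 - s * (xp - x0)) + s * dif)
    by (unfold dif; ring).
  pose proof (HM xm ltac:(lra)) as Mm. pose proof (HM xp ltac:(lra)) as Mp.
  assert (Sd : Rabs (s * dif) <= Rabs s * Rabs dif) by (rewrite Rabs_mult; lra).
  assert (0 <= Rabs s * Rabs dif) by (apply Rmult_le_pos; apply Rabs_pos).
  apply Rabs_le_between in Sb. apply Rabs_le_between in Sd.
  apply Rabs_le_between in Mm. apply Rabs_le_between in Mp.
  apply Rabs_le. nra.
Qed.

Theorem theorem2
  (k : nat) (f : R -> R -> R) (m gamma q epsstar p a : R)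
  (hk : (2 <= k)%nat)
  (hf : Ck_strip k f)
  (hm : 0 < m)
  (hfy_m : forall x v : R, 0 <= x <= 1 -> m <= Derive (f x) v)
  (hfy_gamma : forall x v : R, 0 <= x <= 1 -> Derive (f x) v <= gamma)
  (hq : 0 < q)
  (hepsstar : 0 < epsstar < 1 / 8)
  (hp : Rpower epsstar (1 / 3) < p < 1 / 2)
  (ha : 0 < a)
  (homega : forall eps : R, 0 < eps <= epsstar -> 0 <= omega a p eps) :
  exists C : R, 0 < C /\
    forall (eps : R) (N : nat) (y : R -> R) (ybar : nat -> R),
      0 < eps <= epsstar ->
      Nat.Even N -> (4 <= N)%nat ->
      bvp_solution f eps y ->
      discrete_solution f gamma q eps N (mesh a p eps N) ybar ->
      Rmax_N (fun i : nat => Rabs (y (mesh a p eps N i) - ybar i)) N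
        <= C / INR N ^ 2.
Proof.
  destruct (smooth_monotone_of_Ck k f m gamma hk hf hm hfy_m hfy_gamma)
    as [fx [fv [fxx [fxv [fvx [fvv HS]]]]]].
  (* Half of the decay rate sqrt m: d^2 < m leaves room in the barrier for y''. *)
  set (d := sqrt m / 2). set (es := Rpower epsstar (1 / 3)) in *.
  assert (Hd : 0 < d) by (unfold d; pose proof (sqrt_lt_R0 m hm); lra).
  assert (Hdm : 4 * d ^ 2 = m).
  { unfold d. replace (4 * (sqrt m / 2) ^ 2) with (sqrt m ^ 2) by field.
    apply pow2_sqrt; lra. }
  assert (Hgamma := gamma_pos f fx fv fxx fxv fvx fvv m gamma HS).
  destruct (reduced_bounds f fx fv fxx fxv fvx fvv m gamma d HS Hd Hdm) as [A [PA HA]].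
  set (Cm := C_mesh a p d es).
  assert (PCm : 0 < Cm) by (apply C_mesh_pos; lra).
  assert (Pd : 0 < 2 / d) by (apply Rdiv_lt_0_compat; lra).
  set (C := (q + 4) * (A * (2 + 2 / d) * Cm) / ((q + 2) * m)).
  exists C. split.
  { unfold C. apply Rdiv_lt_0_compat; repeat apply Rmult_lt_0_compat; lra. }
  intros eps N y ybar He HEven HN Hbvp Hdisc.
  destruct (solution_of_bvp f eps y ltac:(lra) Hbvp) as [y1 Y].
  set (e := Rpower eps (1 / 3)).
  assert (Pe : 0 < e) by apply exp_pos.
  assert (Hes : e <= es) by (apply Rle_Rpower_l; lra).
  assert (He3 : eps = e ^ 3).
  { unfold e. rewrite <- Rpower_pow by apply exp_pos. rewrite Rpower_mult.
    replace (1 / 3 * INR 3) with 1 by (simpl; field). symmetry; apply Rpower_1; lra. }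
  set (x := mesh a p eps N).
  assert (HNpos : (0 < N)%nat) by lia.
  assert (PN : 0 < INR N) by now apply lt_0_INR.
  assert (Hom := homega eps He).
  assert (Unit : forall j, (j <= N)%nat -> unit_interval (x j)).
  { intros j Hj. apply (mesh_unit a p es e eps); auto; lra. }
  assert (Inc : forall j, (j < N)%nat -> x j < x (j + 1)%nat).
  { intros j Hj. rewrite Nat.add_1_r. apply (mesh_increasing a p es e eps); auto; lra. }
  assert (Dec : forall j, (0 < j <= N)%nat -> x (j - 1)%nat < x j).
  { intros j Hj. pose proof (Inc (j - 1)%nat ltac:(lia)) as Q.
    now replace (j - 1 + 1)%nat with j in Q by lia. }
  apply Rmax_N_le. intros i Hi.
  apply Rle_trans with ((q + 4) * (A * (2 + 2 / d) * (Cm * (/ INR N) ^ 2)) / ((q + 2) * m)).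
  2:{ right. unfold C. field. repeat split; nra. }
  revert i Hi.
  apply (discrete_maximum_principle (fun j => y (x j) - ybar j)).
  - apply Rmult_lt_0_compat; lra.
  - apply Rmult_le_pos; [lra|]. apply Rmult_le_pos; [apply Rmult_le_pos; lra|].
    apply Rmult_le_pos; [lra|apply pow2_ge_0].
  - unfold x. rewrite (mesh_0 a p es e eps) by (auto; lra). rewrite (sol_0 _ _ _ _ Y).
    pose proof (Hdisc 0%nat ltac:(lia)) as Q. unfold F in Q. simpl in Q. lra.
  - unfold x. rewrite (mesh_N a p es e eps) by (auto; lra). rewrite (sol_1 _ _ _ _ Y).
    pose proof (Hdisc N ltac:(lia)) as Q. unfold F in Q.
    rewrite Nat.eqb_refl in Q. destruct (N =? 0)%nat eqn:EN; [|lra].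
    apply Nat.eqb_eq in EN. lia.
  - intros i Hi.
    assert (Hb : 0 < beta gamma eps)
      by (unfold beta; apply Rdiv_lt_0_compat; [now apply sqrt_lt_R0|lra]).
    assert (Hh : 0 < beta gamma eps * step x (i - 1)).
    { apply Rmult_lt_0_compat; [exact Hb|]. unfold step.
      replace (S (i - 1)) with i by lia. pose proof (Dec i ltac:(lia)). lra. }
    assert (Hk : 0 < beta gamma eps * step x i).
    { apply Rmult_lt_0_compat; [exact Hb|]. unfold step.
      rewrite <- Nat.add_1_r. pose proof (Inc i ltac:(lia)). lra. }
    destruct (error_equation f fv m gamma q eps x (fun j => y (x j)) ybar i)
      as [P [Q [c [HP [HQ [Hc E]]]]]]; auto; try lia.
    { intros j v Hj. apply (sm_f _ _ _ _ _ _ _ _ _ HS). apply Unit; lia. }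
    { intros j v Hj. apply (sm_fv_bounds _ _ _ _ _ _ _ _ _ HS). apply Unit; lia. }
    exists P, Q, c. repeat split; auto. simpl. rewrite <- E.
    assert (Z : F_interior f gamma q eps x ybar i = 0).
    { pose proof (Hdisc i ltac:(lia)) as Z. unfold F in Z.
      rewrite (proj2 (Nat.eqb_neq i 0)), (proj2 (Nat.eqb_neq i N)) in Z by lia. exact Z. }
    rewrite Z, Rminus_0_r.
    destruct (Unit (i - 1)%nat ltac:(lia)) as [U0 _].
    destruct (Unit (i + 1)%nat ltac:(lia)) as [_ U1].
    pose proof (Dec i ltac:(lia)) as I0. pose proof (Inc i ltac:(lia)) as I1.
    destruct (affine_approximation (reduced f gamma y) (reduced1 fx fv gamma y y1)
      (reduced2 f fv fxx fxv fvx fvv gamma eps y y1) A Cm d eps (/ INR N)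
      (x (i - 1)%nat) (x i) (x (i + 1)%nat)) as [s [M [HM HMs]]]; auto; try lra.
    + intros z Uz. now apply (reduced_derive f fx fv fxx fxv fvx fvv m gamma HS eps).
    + intros z Uz. now apply (reduced_derive f fx fv fxx fxv fvx fvv m gamma HS eps).
    + intros z Uz. now apply HA.
    + intros z Uz. now apply HA.
    + apply (mesh_resolved a p d es e eps); auto; lra.
    + eapply Rle_trans; [apply (truncation_error f gamma q eps y y1 x i s M); auto; lia|].
      apply Rmult_le_compat_l; lra.
Qed.
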